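(* Let $A$ and $B$ be positive definite operators on a Hilbert space $H$. If $r\geqslant 1$, $p>p_0\geqslant 0$, for a nonnegative integer $n$ such that $p+r=(n+1)\left((2p_0+1)+r\right)$, the following assertions are equivalent. (3-1) $A\geqslant B>0$. (3-6) $\left(A^{\frac r2}B^{p_0}A^{\frac r2}\right)^{\frac{2p_0+1+r}{p_0+r}}\geqslant \left(A^{\frac r2}B^{p}A^{\frac r2}\right)^{\frac{1}{n+1}}$. (3-7) There exists a unique $S>0$ with $\|S\|\leqslant 1$ such that $$B^{p}=A^{-\frac r2}\left(A^{\frac r2}B^{p_0}A^{\frac r2}\right)^{\frac{2p_0+1+r}{2p_0+2r}}S\left(\left(A^{\frac r2}B^{p_0}A^{\frac r2}\right)^{\frac{2p_0+1+r}{p_0+r}}S\right)^{n}\left(A^{\frac r2}B^{p_0}A^{\frac r2}\right)^{\frac{2p_0+1+r}{2p_0+2r}}A^{-\frac r2}$$ $$=A^{-\frac r2}\left(A^{\frac r2}B^{p_0}A^{\frac r2}\right)^{\frac{2p_0+1+r}{2p_0+2r}}\left(S\left(A^{\frac r2}B^{p_0}A^{\frac r2}\right)^{\frac{2p_0+1+r}{p_0+r}}\right)^{n}S\left(A^{\frac r2}B^{p_0}A^{\frac r2}\right)^{\frac{2p_0+1+r}{2p_0+2r}}A^{-\frac r2}.$$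
   Context: Operators are bounded linear operators on a Hilbert space $H$. An operator $X$ is positive, $X\geqslant 0$, if $\langle Xx,x\rangle\geqslant 0$ for all $x\in H$; $X\geqslant Y$ means that $X,Y$ are self-adjoint and $X-Y\geqslant 0$. $X>0$ means that $X$ is positive definite (positive and invertible). Real powers of positive definite operators are taken by the continuous functional calculus; $\|\cdot\|$ is the operator norm.
   Formalization: For one fixed (p0,p,n), (3-6) or (3-7) need not imply (3-1) (e.g. r=2, p0=0, n=1, p=4); the theorem proved derives (3-1) from (3-6), or from (3-7), holding for all admissible p0, p, n at fixed r; the other implications hold for each choice. *)

(* Defs.v *)
From mathcomp Require Import all_boot all_order all_algebra.
From mathcomp Require Import all_classical all_reals all_analysis.
From mathcomp Require Import complex.

Set Implicit Arguments.
Unset Strict Implicit.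
Unset Printing Implicit Defensive.

Import Order.TTheory GRing.Theory Num.Theory.
Import numFieldNormedType.Exports.

Local Open Scope classical_set_scope.
Local Open Scope ring_scope.
Local Open Scope complex_scope.

(* A complex Hilbert space is a complete normed space over [R[i]], where R is
   the field of real numbers, whose norm comes from the inner product [dot].
   The form is linear in its first argument and conjugate-linear in the
   second. *)
Definition hilbert_form (R : realType) (H : completeNormedModType R[i])
    (dot : {dot H for (@Num.conj R[i])}) : Prop :=
  forall x : H, `|x| ^+ 2 = dot x x.

Section Operators.
Variables (R : realType) (H : completeNormedModType R[i]).
Variable dot : {dot H for (@Num.conj R[i])}.

(* Operators are plain functions subject to [bounded_operator]; composition is
   [\o], the n-th power of T is [iter n T], and sums and scalar multiples are
   the pointwise ones. *)
Definition bounded_operator (T : H -> H) : Prop :=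
  linear T /\ bounded_near T (nbhs (0 : H)).

(* Norms of vectors are elements of [R[i]] with zero imaginary part. *)
Definition opnorm (T : H -> H) : R :=
  sup [set complex.Re `|T x| | x in [set x : H | `|x| <= 1]].

Definition self_adjoint (T : H -> H) : Prop :=
  bounded_operator T /\ forall x y, dot (T x) y = dot x (T y).

(* In [R[i]], [0 <= z] means that z is real and nonnegative. *)
Definition op_nonneg (T : H -> H) : Prop :=
  bounded_operator T /\ forall x, 0 <= dot (T x) x.

Definition op_ge (X Y : H -> H) : Prop :=
  [/\ self_adjoint X, self_adjoint Y & op_nonneg (X \- Y)].

Definition op_invertible (T : H -> H) : Prop :=
  exists V : H -> H, [/\ bounded_operator V, T \o V = id & V \o T = id].

Definition posdef (T : H -> H) : Prop := op_nonneg T /\ op_invertible T.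

Definition spectrum (T : H -> H) : set R[i] :=
  [set z | ~ op_invertible (fun x => T x - z *: x)].

Definition poly_op (q : {poly R[i]}) (T : H -> H) : H -> H :=
  fun x => \sum_(i < size q) q`_i *: iter i T x.

(* X is f(T) in the continuous functional calculus of a self-adjoint T: the
   limit in operator norm of q_n(T) for polynomials q_n that converge to f
   uniformly on the spectrum. *)
Definition is_functional_calculus (T : H -> H) (f : R[i] -> R[i])
    (X : H -> H) : Prop :=
  bounded_operator X /\
  exists q : nat -> {poly R[i]},
    (forall e : R, 0 < e ->
      \forall n \near \oo, forall z, spectrum T z ->
        `|(q n).[z] - f z| <= e%:C) /\
    opnorm (poly_op (q n) T \- X) @[n --> \oo] --> (0 : R).

(* The real power T^s. It is meant for positive definite T: the spectrum is
   then a compact subset of ]0, +oo[, the value of [powR] at 0 plays no role,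
   and there is exactly one X to choose. *)
Definition oppow (T : H -> H) (s : R) : H -> H :=
  xget \0 [set X | is_functional_calculus T (fun z => (complex.Re z `^ s)%:C) X].

Definition sandwich (A B : H -> H) (r q : R) : H -> H :=
  oppow A (r / 2) \o oppow B q \o oppow A (r / 2).

Definition admissible (r p0 p : R) (n : nat) : Prop :=
  [/\ 0 <= p0, p0 < p & p + r = n.+1%:R * ((2 * p0 + 1) + r)].

(* For one fixed (r, p0, p, n) this need not imply A >= B: with r = 2, p0 = 0,
   n = 1, p = 4, B = diag(2, 1) and A = [[3, 1.1], [1.1, 2]] it holds, but
   det (A - B) = - 0.21. It implies A >= B when required for all admissible
   (p0, p, n). *)
Definition sandwich_ineq (A B : H -> H) (r p0 p : R) (n : nat) : Prop :=
  op_ge (oppow (sandwich A B r p0) ((2 * p0 + 1 + r) / (p0 + r)))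
        (oppow (sandwich A B r p) (n.+1%:R^-1)).

Definition equation_contraction (A B : H -> H) (r p0 p : R) (n : nat)
    (S : H -> H) : Prop :=
  let M := sandwich A B r p0 in
  let X := oppow M ((2 * p0 + 1 + r) / (p0 + r)) in
  let Y := oppow M ((2 * p0 + 1 + r) / (2 * p0 + 2 * r)) in
  let Ainv := oppow A (- (r / 2)) in
  [/\ posdef S, opnorm S <= 1,
      oppow B p = Ainv \o Y \o S \o iter n (X \o S) \o Y \o Ainv
    & oppow B p = Ainv \o Y \o iter n (S \o X) \o S \o Y \o Ainv].

End Operators.

(* Main.v *)
From HB Require Import structures.
Require Import Defs.
From mathcomp Require Import all_boot all_order all_algebra.
From mathcomp Require Import all_classical all_reals all_analysis.
From mathcomp Require Import complex.
From mathcomp Require Import ring lra.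

Set Implicit Arguments.
Unset Strict Implicit.
Unset Printing Implicit Defensive.

Import Order.TTheory GRing.Theory Num.Theory.
Import numFieldNormedType.Exports.

Local Open Scope ring_scope.

(** Write [q = 2 p0 + 1], [M = A^(r/2) B^p0 A^(r/2)], [N = A^(r/2) B^p A^(r/2)] and
    [X = M^((q + r)/(p0 + r))]. The hypothesis on [p] says
    [1/(n + 1) = (q + r)/(p + r)], so the inequality is [N^((q + r)/(p + r)) <= X].

    Let [B <= A]. The identity [(C D^2 C)^(1 + s) = C D (D C^2 D)^s D C]
    ([sandwich_pow]), with [C = A^(r/2)] and [D] the power [p0/2] or [p/2] of [B],
    exposes powers of [B^(t/2) A^r B^(t/2)] for [t = p0] and [t = p]. The Furuta
    inequality [(B^(t/2) A^r B^(t/2))^((1 + t)/(t + r)) >= B^(1 + t)] ([furuta]) then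
    shows that [X >= A^(r/2) B^q A^(r/2) >= N^(1/(n + 1))] ([sandwich_mono]).
    Conversely [p0 = 0], [n = 0], [p = 1] gives [A^(1 + r) >= A^(r/2) B A^(r/2)],
    hence [A >= B] ([ineq_order]).

    The equation for [S] telescopes. With [Y^2 = X], both products become
    [N = (Y S Y)^(n + 1)], that is [Y S Y = N^(1/(n + 1))]; so the only candidate is
    [S = Y^-1 N^(1/(n + 1)) Y^-1], and [|S| <= 1] means [Y S Y <= Y^2 = X], which is
    the inequality ([ineq_equation]).

    The Furuta inequality rests on the Loewner-Heinz inequality
    ([loewner_heinz]), which follows from the monotonicity of the square root
    ([square_mono]) by taking midpoints of exponents and limits.

    Real powers are limits of polynomials that converge uniformly on the
    spectrum. They are governed by the estimate that the norm of [q(T)] is at most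
    the supremum of [|q|] on the spectrum ([poly_op_norm]). It holds because a
    polynomial that is nonnegative on the spectrum gives a nonnegative operator:
    otherwise [q(T) - m], for the infimum [m < 0] of the form, would be invertible
    by factoring [q - m], hence bounded below. Neumann series locate the spectrum
    between the bounds of the form ([spectrum_bounds]), Bernstein polynomials
    provide the approximation ([lipschitz_approximable]), and the rules for
    exponents pass to the limit from polynomials ([calculus]). *)

(** * The real inner product *)

Section RealInnerProduct.
Variables (R : realType) (H : completeNormedModType R[i]).
Variable dot : {dot H for (@Num.conj R[i])}.
Hypothesis Hdot : hilbert_form dot.
Local Open Scope complex_scope.

Local Notation normc := Normc.normc.

Definition vnorm (x : H) : R := complex.Re `|x|.
(** Order relations between operators only involve this real part, and it
    determines [dot] because the space is complex. *)
Definition rip (x y : H) : R := complex.Re (dot x y).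

Local Notation ip := rip.

Lemma vnormE x : `|x| = (vnorm x)%:C.
Proof. by rewrite /vnorm RRe_real // normr_real. Qed.

Lemma norm_normc (z : R[i]) : `|z| = (normc z)%:C.
Proof. by case: z. Qed.

Lemma normc_ge0 (z : R[i]) : 0 <= normc z.
Proof. by case: z => a b; exact: sqrtr_ge0. Qed.

Lemma vnorm_ge0 x : 0 <= vnorm x.
Proof. by rewrite -lecR -vnormE normr_ge0. Qed.

Lemma vnorm0 : vnorm 0 = 0.
Proof. by rewrite /vnorm normr0. Qed.

Lemma vnorm_eq0 x : vnorm x = 0 -> x = 0.
Proof. by move=> h; apply/normr0_eq0; rewrite vnormE h. Qed.

Lemma vnormZ z x : vnorm (z *: x) = normc z * vnorm x.
Proof.
by apply: complexI; rewrite -vnormE normrZ norm_normc vnormE rmorphM.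
Qed.

Lemma normc_real (a : R) : normc a%:C = `|a|.
Proof. by rewrite /= expr0n addr0 sqrtr_sqr. Qed.

Lemma norm_le1 x : (`|x| <= 1) = (vnorm x <= 1).
Proof. by rewrite vnormE -(rmorph1 (real_complex R)) lecR. Qed.

Lemma vnormN x : vnorm (- x) = vnorm x.
Proof. by rewrite /vnorm normrN. Qed.

Lemma vnormD x y : vnorm (x + y) <= vnorm x + vnorm y.
Proof. by rewrite -lecR rmorphD /= -!vnormE ler_normD. Qed.

Lemma vnormB x y : vnorm (x - y) <= vnorm x + vnorm y.
Proof. by rewrite (le_trans (vnormD _ _)) // vnormN. Qed.

Lemma dotC x y : dot x y = (dot y x)^*.
Proof. by rewrite hermC expr0 mul1r. Qed.

Lemma dotDl x y z : dot (x + y) z = dot x z + dot y z.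
Proof. by rewrite linearDl. Qed.

Lemma dotZl a x y : dot (a *: x) y = a * dot x y.
Proof. by rewrite linearZl_LR. Qed.

Lemma dotDr x y z : dot x (y + z) = dot x y + dot x z.
Proof. by rewrite dotC dotDl rmorphD /= -!dotC. Qed.

Lemma dotZr a x y : dot x (a *: y) = a^* * dot x y.
Proof. by rewrite dotC dotZl rmorphM /= -!dotC. Qed.

Lemma dot0l y : dot 0 y = 0.
Proof. by rewrite -(scale0r 0) dotZl mul0r. Qed.

Lemma dot0r x : dot x 0 = 0.
Proof. by rewrite dotC dot0l conjc0. Qed.

Lemma dotZr_real (a : R) x y : dot x (a%:C *: y) = a%:C * dot x y.
Proof. by rewrite dotZr; congr (_ * _); apply/eqP; rewrite eq_complex /= oppr0 !eqxx. Qed.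

Lemma ipC x y : ip x y = ip y x.
Proof. by rewrite /rip dotC; case: (dot y x). Qed.

Lemma ipDl x y z : ip (x + y) z = ip x z + ip y z.
Proof. by rewrite /rip dotDl raddfD. Qed.

Lemma ipDr x y z : ip x (y + z) = ip x y + ip x z.
Proof. by rewrite !(ipC x) ipDl. Qed.

Lemma ipZl (a : R) x y : ip (a%:C *: x) y = a * ip x y.
Proof. by rewrite /rip dotZl; case: (dot x y) => u v /=; rewrite mul0r subr0. Qed.

Lemma ipZr (a : R) x y : ip x (a%:C *: y) = a * ip x y.
Proof. by rewrite ipC ipZl ipC. Qed.

Lemma ipNl x y : ip (- x) y = - ip x y.
Proof. by rewrite -[- x]scaleN1r -(rmorphN1 (real_complex R)) ipZl mulN1r. Qed.

Lemma ipNr x y : ip x (- y) = - ip x y.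
Proof. by rewrite ipC ipNl ipC. Qed.

Lemma ip0l y : ip 0 y = 0.
Proof. by rewrite -(scale0r y) (ipZl 0) mul0r. Qed.

Lemma ipxx x : ip x x = vnorm x ^+ 2.
Proof. by rewrite /rip -Hdot vnormE -rmorphXn. Qed.

Lemma ip_ge0 x : 0 <= ip x x.
Proof. by rewrite ipxx exprn_ge0 // vnorm_ge0. Qed.

Lemma im_dot x y : complex.Im (dot x y) = ip x ('i%C *: y).
Proof. by rewrite /rip dotZr; case: (dot x y) => u v /=; ring. Qed.

Lemma dot_ext x y x' y' : (forall z : R[i], ip x (z *: y) = ip x' (z *: y')) ->
  dot x y = dot x' y'.
Proof.
move=> h; move: (h 1) (h 'i%C); rewrite !scale1r -!im_dot /rip.
by case: (dot x y) => ? ?; case: (dot x' y') => ? ? /= -> ->.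
Qed.

Lemma discriminant (a b c : R) :
  (forall t, 0 <= a + 2 * t * b + t ^+ 2 * c) -> 0 <= c -> b ^+ 2 <= a * c.
Proof.
move=> h c0; have [c_0|cn0] := eqVneq c 0.
  have [->|b0] := eqVneq b 0; first by rewrite c_0 mulr0 expr0n.
  have := h (- (a + 1) / (2 * b)); rewrite c_0 mulr0 addr0.
  have -> : a + 2 * (- (a + 1) / (2 * b)) * b = -1 by field.
  by rewrite oppr_ge0 ler10.
have cp : 0 < c by rewrite lt_def cn0.
have := h (- b / c).
have -> : a + 2 * (- b / c) * b + (- b / c) ^+ 2 * c = (a * c - b ^+ 2) / c.
  by field.
by rewrite pmulr_lge0 ?invr_gt0 // subr_ge0.
Qed.

(** Cauchy-Schwarz for the form of a nonnegative symmetric operator: the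
    discriminant of [t |-> <T (x + t y), x + t y>], with [t] real. *)
Lemma form_CS (T : H -> H) x y : linear T ->
  (forall x y, ip (T x) y = ip x (T y)) -> (forall x, 0 <= ip (T x) x) ->
  ip (T x) y ^+ 2 <= ip (T x) x * ip (T y) y.
Proof.
move=> lT sT pT; apply: discriminant => // t.
have := pT (t%:C *: y + x); rewrite lT !(ipDl, ipDr, ipZl, ipZr).
by rewrite (sT y x) (ipC y); lra.
Qed.

Lemma ip_CS x y : `|ip x y| <= vnorm x * vnorm y.
Proof.
rewrite -(ler_pXn2r (n := 2)) ?nnegrE ?mulr_ge0 ?vnorm_ge0 //.
rewrite exprMn -!ipxx real_normK ?num_real //.
exact: (form_CS (T := id) _ _ _ _ ip_ge0).
Qed.

End RealInnerProduct.

(** * Bounded operators *)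

Section BoundedOperators.
Variables (R : realType) (H : completeNormedModType R[i]).
Local Open Scope classical_set_scope.
Local Open Scope ring_scope.
Local Open Scope complex_scope.
Implicit Types (T U : H -> H) (x y : H).
Local Notation normc := Normc.normc.

Section LinearMaps.
Variables (T : H -> H) (lT : linear T).

Lemma lin0 : T 0 = 0.
Proof. by have := lT (-1) 0 0; rewrite !scaleN1r !addNr. Qed.

Lemma linD x y : T (x + y) = T x + T y.
Proof. by have := lT 1 x y; rewrite !scale1r. Qed.

Lemma linZ z x : T (z *: x) = z *: T x.
Proof. by have := lT z x 0; rewrite lin0 !addr0. Qed.

Lemma linN x : T (- x) = - T x.
Proof. by rewrite -scaleN1r linZ scaleN1r. Qed.

Lemma linB x y : T (x - y) = T x - T y.
Proof. by rewrite linD linN. Qed.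

End LinearMaps.

Lemma bounded_operatorP T : bounded_operator T <->
  linear T /\ exists2 c, 0 <= c & forall x, vnorm (T x) <= c * vnorm x.
Proof.
split=> [[lT bT]|[lT [c c0 bT]]]; split=> //.
  pose f : {linear H -> H} := HB.pack T (GRing.isLinear.Build _ _ _ _ T lT).
  move: bT => /(linear_boundedP f) /pinfty_ex_gt0 [M M0 bM].
  have Mr : M = (complex.Re M)%:C by rewrite RRe_real // gtr0_real.
  exists (complex.Re M) => [|x]; first by rewrite -lecR -Mr ltW.
  by rewrite -lecR rmorphM /= -!vnormE -Mr; exact: bM.
pose f : {linear H -> H} := HB.pack T (GRing.isLinear.Build _ _ _ _ T lT).
apply/(linear_boundedP f); exists c%:C; split; first by rewrite ger0_real // lecR.
move=> r rc x; rewrite (le_trans (y := c%:C * `|x|)) //.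
  by rewrite !vnormE -rmorphM lecR.
by rewrite ler_wpM2r // ltW.
Qed.

Lemma bop_lin T : bounded_operator T -> linear T.
Proof. by case. Qed.

Lemma bop_bound T : bounded_operator T ->
  exists2 c, 0 < c & forall x, vnorm (T x) <= c * vnorm x.
Proof.
move=> /bounded_operatorP[_ [c c0 bT]]; exists (c + 1) => [|x].
  by rewrite ltr_wpDl.
by rewrite (le_trans (bT x)) // ler_wpM2r ?vnorm_ge0 // lerDl.
Qed.

Lemma bop_id : bounded_operator (@id H).
Proof.
by apply/bounded_operatorP; split=> //; exists 1 => // x; rewrite mul1r.
Qed.

Lemma bop_comp T U : bounded_operator T -> bounded_operator U ->
  bounded_operator (T \o U).
Proof.
move=> /bounded_operatorP[lT [c c0 bT]] /bounded_operatorP[lU [d d0 bU]].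
apply/bounded_operatorP; split=> [a x y /=|]; first by rewrite lU lT.
exists (c * d) => [|x /=]; first exact: mulr_ge0.
by rewrite (le_trans (bT _)) // -mulrA ler_wpM2l.
Qed.

Lemma bop_add T U : bounded_operator T -> bounded_operator U ->
  bounded_operator (fun x => T x + U x).
Proof.
move=> /bounded_operatorP[lT [c c0 bT]] /bounded_operatorP[lU [d d0 bU]].
apply/bounded_operatorP; split=> [a x y /=|].
  by rewrite lU lT scalerDr addrACA.
exists (c + d) => [|x /=]; first exact: addr_ge0.
by rewrite (le_trans (vnormD _ _)) // mulrDl lerD.
Qed.

Lemma bop_scale z T : bounded_operator T -> bounded_operator (fun x => z *: T x).
Proof.
move=> /bounded_operatorP[lT [c c0 bT]].
have z0 := normc_ge0 z.
apply/bounded_operatorP; split=> [a x y /=|].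
  by rewrite lT scalerDr !scalerA mulrC.
exists (normc z * c) => [|x /=]; first by rewrite mulr_ge0.
by rewrite vnormZ -mulrA ler_wpM2l.
Qed.

Lemma eq_bop T U : T =1 U -> bounded_operator T -> bounded_operator U.
Proof. by move=> /funext ->. Qed.

Lemma bop_opp T : bounded_operator T -> bounded_operator (fun x => - T x).
Proof.
by move=> /(bop_scale (-1)); apply: eq_bop => x; rewrite scaleN1r.
Qed.

Lemma bop_sub T U : bounded_operator T -> bounded_operator U ->
  bounded_operator (fun x => T x - U x).
Proof. by move=> bT /bop_opp bU; exact: bop_add bT bU. Qed.

Lemma opnorm_bound T x : bounded_operator T ->
  vnorm (T x) <= opnorm T * vnorm x.
Proof.
move=> /bounded_operatorP[lT [c c0 bT]].
have [->|x0] := eqVneq x 0; first by rewrite lin0 // !vnorm0 mulr0.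
have xn : 0 < vnorm x.
  by rewrite lt_def vnorm_ge0 andbT; apply: contra_neq x0; exact: vnorm_eq0.
rewrite -ler_pdivrMr //.
apply: ub_le_sup.
  exists c => _ [y /= y1 <-]; rewrite (le_trans (bT y)) // ler_piMr //.
  by rewrite -norm_le1.
have ax : normc (vnorm x)^-1%:C = (vnorm x)^-1.
  by rewrite normc_real ger0_norm // invr_ge0 vnorm_ge0.
exists ((vnorm x)^-1%:C *: x) => /=.
  by rewrite norm_le1 vnormZ ax mulVf // gt_eqF.
by rewrite -/(vnorm _) linZ // vnormZ ax mulrC.
Qed.

Lemma opnorm_le T c : 0 <= c -> (forall x, vnorm (T x) <= c * vnorm x) ->
  opnorm T <= c.
Proof.
move=> c0 bT; apply: ge_sup.
  by exists (complex.Re `|T 0|), 0 => //=; rewrite normr0.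
move=> _ [y /= y1 <-]; rewrite (le_trans (bT y)) // ler_piMr //.
by rewrite -norm_le1.
Qed.

Lemma opnorm_ge0 T : bounded_operator T -> 0 <= opnorm T.
Proof.
move=> bT; apply: ub_le_sup; last first.
  by exists 0 => /=; rewrite ?normr0 ?lin0 ?normr0 //; case: bT.
have [c c0 h] := bop_bound bT.
exists c => _ [y /= y1 <-]; rewrite (le_trans (h y)) // ler_piMr //; first exact: ltW.
by rewrite -norm_le1.
Qed.

(** Operators that are uniformly Cauchy on the unit ball converge pointwise,
    at the same rate, by completeness of the space. *)
Lemma op_limit (u : nat -> H -> H) (e : nat -> R) :
  (forall n, linear (u n)) ->
  (forall n m x, (n <= m)%N -> vnorm (u m x - u n x) <= e n * vnorm x) ->
  (forall d, 0 < d -> exists n, e n <= d) ->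
  exists2 X, linear X & forall n x, vnorm (X x - u n x) <= e n * vnorm x.
Proof.
move=> lu cu e0.
have small c d : 0 <= c -> 0 < d -> exists n, e n * c <= d.
  move=> c0 d0; have [n hn] := e0 (d / (c + 1)) (divr_gt0 d0 (ltr_wpDl c0 ltr01)).
  exists n; rewrite (le_trans (ler_wpM2r c0 hn)) // -mulrA ler_piMr ?(ltW d0) //.
  by rewrite mulrC ler_pdivrMr ?mul1r ?lerDl // ltr_wpDl.
pose X x : H := lim (u n x @[n --> \oo]).
have cX x : u n x @[n --> \oo] --> X x.
  apply/cauchy_cvgP; apply/cauchy_exP => eps eps0.
  have epsr : eps = (complex.Re eps)%:C by rewrite RRe_real // gtr0_real.
  have eps0' : 0 < complex.Re eps / 2.
    by rewrite divr_gt0 // -ltcR -epsr.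
  have [n hn] := small (vnorm x) _ (vnorm_ge0 x) eps0'.
  exists (u n x); exists n => // m /= nm.
  rewrite -ball_normE /= distrC vnormE epsr ltcR.
  rewrite (le_lt_trans (cu _ _ x nm)) // (le_lt_trans hn) //.
  by rewrite ltr_pdivrMr // ltr_pMr ?ltr1n // -ltcR -epsr.
have hX n x : vnorm (X x - u n x) <= e n * vnorm x.
  apply/ler_addgt0Pl => d d0.
  move/cvgrPdist_le : (cX x) => /(_ d%:C); rewrite (ltcR 0) => /(_ d0) [m _ hm].
  rewrite (_ : X x - u n x = (X x - u (maxn m n) x) + (u (maxn m n) x - u n x)).
    rewrite (le_trans (vnormD _ _)) // lerD ?cu ?leq_maxr //.
    by rewrite -lecR -vnormE; apply: hm => /=; rewrite leq_maxl.
  by rewrite addrA subrK.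
exists X => // a x y.
apply/eqP; rewrite -subr_eq0; apply/eqP/vnorm_eq0/eqP.
rewrite eq_le vnorm_ge0 andbT; apply/ler_addgt0Pl => d d0; rewrite addr0.
have [n hn] := small (vnorm (a *: x + y) + normc a * vnorm x + vnorm y) d
   (addr_ge0 (addr_ge0 (vnorm_ge0 _) (mulr_ge0 (normc_ge0 _) (vnorm_ge0 _)))
     (vnorm_ge0 _)) d0.
apply: le_trans hn.
rewrite (_ : X _ - _ = (X (a *: x + y) - u n (a *: x + y))
   - a *: (X x - u n x) - (X y - u n y)); last first.
  rewrite -{1}(subrK (u n (a *: x + y)) (X (a *: x + y))) -{1}(subrK (u n x) (X x)).
  rewrite -{1}(subrK (u n y) (X y)) [in X in X - _]lu (scalerDr a (_ - _)).
  by rewrite [X in _ - X = _]addrACA [X in _ - X = _]addrC addrKA lu !opprD !addrA.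
rewrite !mulrDr (le_trans (vnormB _ _)) // lerD // (le_trans (vnormB _ _)) //.
rewrite lerD // vnormZ mulrCA ler_wpM2l //.
exact: normc_ge0.
Qed.

End BoundedOperators.

(** * Symmetric operators and lower bounds *)

Section Spectrum.
Variables (R : realType) (H : completeNormedModType R[i]).
Variable dot : {dot H for (@Num.conj R[i])}.
Hypothesis Hdot : hilbert_form dot.
Local Open Scope complex_scope.
Implicit Types (T U D : H -> H) (x y : H).
Local Notation ip := (rip dot).
Local Notation self_adjoint := (self_adjoint dot).
Local Notation op_nonneg := (op_nonneg dot).

Lemma sa_bop T : self_adjoint T -> bounded_operator T.
Proof. by case. Qed.

Lemma sa_lin T : self_adjoint T -> linear T.
Proof. by case=> -[]. Qed.

Lemma sa_ip T : self_adjoint T -> forall x y, ip (T x) y = ip x (T y).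
Proof. by case=> _ h x y; rewrite /rip h. Qed.

Lemma sa_of_ip T : bounded_operator T ->
  (forall x y, ip (T x) y = ip x (T y)) -> self_adjoint T.
Proof.
move=> bT h; split=> // x y; apply: dot_ext => z.
by rewrite h linZ //; exact: bop_lin.
Qed.

(** On a complex space the quadratic form determines the operator, by
    polarization, so a real quadratic form makes the operator symmetric. *)
Lemma op_nonnegP T : op_nonneg T <-> self_adjoint T /\ forall x, 0 <= ip (T x) x.
Proof.
split=> [[bT pT]|[sT pT]]; last first.
  split=> [|x]; first by case: sT.
  have := dotC dot (T x) x; have := pT x; rewrite -(proj2 sT) /rip.
  case: (dot (T x) x) => u v /= u0 [/eqP]; rewrite -subr_eq0 opprK -mulr2n.
  by rewrite mulrn_eq0 /= => /eqP ->; rewrite ler0c.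
have lT := bop_lin bT.
have imT x : complex.Im (dot (T x) x) = 0 by exact: ger0_Im.
have im_sum x y : complex.Im (dot (T x) y) + complex.Im (dot (T y) x) = 0.
  have := imT (x + y); rewrite linD // !(dotDl, dotDr) !raddfD /=.
  by rewrite !imT add0r addr0.
split=> [|x]; last by have := pT x; rewrite lecE /= => /andP[].
split=> // x y; rewrite dotC (dotC _ x); congr (_ ^*).
have h1 := im_sum x y; have h2 := im_sum ('i%C *: x) y; move: h1 h2.
rewrite linZ // dotZl dotZr [dot y _]dotC.
case: (dot (T x) y) => a b; case: (dot (T y) x) => c d /= h1 h2.
by congr Complex; lra.
Qed.

Lemma sa_id : self_adjoint id.
Proof. by split => //; exact: bop_id. Qed.

Lemma sa_add T U : self_adjoint T -> self_adjoint U ->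
  self_adjoint (fun x => T x + U x).
Proof.
move=> [bT sT] [bU sU]; split; first exact: bop_add.
by move=> x y; rewrite dotDl dotDr sT sU.
Qed.

Lemma sa_scale (a : R) T : self_adjoint T -> self_adjoint (fun x => a%:C *: T x).
Proof.
move=> [bT sT]; split; first exact: bop_scale.
by move=> x y; rewrite dotZl dotZr_real sT.
Qed.

Lemma eq_sa T U : T =1 U -> self_adjoint T -> self_adjoint U.
Proof. by move=> /funext ->. Qed.

Lemma sa_sub T U : self_adjoint T -> self_adjoint U ->
  self_adjoint (fun x => T x - U x).
Proof.
move=> sT /(sa_scale (-1)) /(sa_add sT).
by apply: eq_sa => x; rewrite rmorphN1 scaleN1r.
Qed.

Lemma sa_shift (a : R) T : self_adjoint T ->
  self_adjoint (fun x => T x - a%:C *: x).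
Proof. by move=> sT; apply: sa_sub => //; exact: sa_scale sa_id. Qed.

Lemma sa_conj T U : self_adjoint T -> self_adjoint U ->
  self_adjoint (T \o U \o T).
Proof.
move=> [bT sT] [bU sU]; split; first exact: (bop_comp (bop_comp bT bU) bT).
by move=> x y /=; rewrite sT sU sT.
Qed.

Lemma sa_upper T : self_adjoint T ->
  exists2 b, 0 < b & forall x, `|ip (T x) x| <= b * ip x x.
Proof.
move=> [/bop_bound[c c0 bT] _]; exists c => // x.
rewrite (le_trans (ip_CS Hdot _ _)) // ipxx // expr2 mulrA.
by rewrite ler_wpM2r ?vnorm_ge0.
Qed.

Lemma sa_norm D k x : self_adjoint D -> 0 <= k ->
  (forall x, 0 <= ip (D x) x <= k * ip x x) -> vnorm (D x) <= k * vnorm x.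
Proof.
move=> sD k0 hD.
have [Dx0|Dx0] := eqVneq (vnorm (D x)) 0.
  by rewrite Dx0 mulr_ge0 ?vnorm_ge0.
have D0 : 0 < vnorm (D x) ^+ 2 by rewrite exprn_gt0 // lt_def Dx0 vnorm_ge0.
rewrite -(ler_pXn2r (n := 2)) ?nnegrE ?mulr_ge0 ?vnorm_ge0 //.
rewrite -(ler_pM2r D0) -expr2 exprMn.
have hp y : 0 <= ip (D y) y by case/andP: (hD y).
have := form_CS x (D x) (sa_lin sD) (sa_ip sD) hp.
rewrite ipxx // => /le_trans; apply.
case/andP: (hD x) => ? hx; case/andP: (hD (D x)) => ? hDx.
by rewrite (le_trans (ler_pM _ _ hx hDx)) // !ipxx //; lra.
Qed.

(** The greatest lower bound of a symmetric operator is attained as a bound,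
    so it is enough to improve every negative lower bound. *)
Lemma bottom_principle D : self_adjoint D ->
  (forall m, m < 0 -> (forall x, m * ip x x <= ip (D x) x) ->
    exists2 c, 0 < c & forall x, (m + c) * ip x x <= ip (D x) x) ->
  forall x, 0 <= ip (D x) x.
Proof.
move=> sD improve.
pose E := [set m : R | m <= 0 /\ forall x, m * ip x x <= ip (D x) x]%classic.
have [b b0 hb] := sa_upper sD.
have E0 : (E !=set0)%classic.
  exists (- b); split=> [|x]; first by rewrite oppr_le0 ltW.
  by rewrite mulNr lerNl (le_trans _ (hb x)) // -normrN ler_norm.
have ubE : has_ubound E by exists 0 => m [].
have supE : E (sup E).
  split=> [|x]; first by apply: ge_sup => // m [].
  have [->|x0] := eqVneq x 0; first by rewrite lin0 ?ip0l ?mulr0 //; exact: sa_lin.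
  have xx : 0 < ip x x.
    rewrite lt_def ip_ge0 // andbT ipxx // sqrf_eq0.
    by apply: contra_neq x0; exact: vnorm_eq0.
  rewrite -ler_pdivlMr //; apply: ge_sup => // m [_ hm].
  by rewrite ler_pdivlMr.
have [sup0|sup0] := eqVneq (sup E) 0.
  by move=> x; have := supE.2 x; rewrite sup0 mul0r.
have supn : sup E < 0 by rewrite lt_def eq_sym sup0 supE.1.
have [c c0 hc] := improve _ supn supE.2.
have : E (Num.min 0 (sup E + c)).
  split=> [|x]; first by rewrite ge_min lexx.
  rewrite (le_trans _ (hc x)) // ler_wpM2r ?ip_ge0 //.
  by rewrite ge_min lexx orbT.
move=> /(ub_le_sup ubE); rewrite ge_min leNgt supn /= gerDl leNgt c0.
by [].
Qed.

End Spectrum.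

(** * Neumann series and location of the spectrum *)

Section Invertibility.
Variables (R : realType) (H : completeNormedModType R[i]).
Variable dot : {dot H for (@Num.conj R[i])}.
Hypothesis Hdot : hilbert_form dot.
Local Open Scope complex_scope.
Implicit Types (T U D P : H -> H) (x y : H).
Local Notation ip := (rip dot).
Local Notation self_adjoint := (self_adjoint dot).

Lemma op_invP T : op_invertible T <->
  exists V, [/\ bounded_operator V, (forall x, T (V x) = x)
                & forall x, V (T x) = x].
Proof.
split=> -[V [bV TV VT]]; exists V; split=> //; try exact: funext.
- by move=> x; rewrite -[LHS]/((T \o V) x) TV.
- by move=> x; rewrite -[LHS]/((V \o T) x) VT.
Qed.

Lemma eq_inv T U : T =1 U -> op_invertible T -> op_invertible U.
Proof. by move=> /funext ->. Qed.

Lemma op_inv_comp T U : op_invertible T -> op_invertible U ->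
  op_invertible (T \o U).
Proof.
move=> /op_invP[V [bV TV VT]] /op_invP[W [bW UW WU]].
apply/op_invP; exists (W \o V); split=> [|x /=|x /=].
- exact: bop_comp.
- by rewrite UW TV.
- by rewrite VT WU.
Qed.

Lemma op_inv_scale (c : R[i]) : c != 0 -> op_invertible (fun x : H => c *: x).
Proof.
move=> c0; apply/op_invP; exists (fun x => c^-1 *: x); split=> [|x|x].
- exact: (bop_scale _ (@bop_id _ _)).
- by rewrite scalerA mulfV // scale1r.
- by rewrite scalerA mulVf // scale1r.
Qed.

Lemma op_inv_lr T U V : bounded_operator U ->
  (forall x, U (T x) = x) -> (forall x, T (V x) = x) -> op_invertible T.
Proof.
move=> bU UT TV; apply/op_invP; exists U; split => // x.
by rewrite -{1}(TV x) UT TV.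
Qed.

Section Neumann.
Variables (K : H -> H) (k : R) (lK : linear K).
Hypotheses (k01 : 0 <= k < 1) (Kk : forall x, vnorm (K x) <= k * vnorm x).

Fixpoint neumann n (x : H) : H :=
  if n is n'.+1 then x + K (neumann n' x) else 0.

Lemma neumann_lin n : linear (neumann n).
Proof.
elim: n => [|n ih] a x y /=; first by rewrite scaler0 addr0.
by rewrite ih lK scalerDr addrACA.
Qed.

Lemma neumann_bound n x : vnorm (neumann n x) <= (1 - k)^-1 * vnorm x.
Proof.
have [k0 k1] := andP k01; have k1' : 0 < 1 - k by rewrite subr_gt0.
elim: n => [|n ih] /=.
  by rewrite vnorm0 mulr_ge0 ?vnorm_ge0 // invr_ge0 ltW.
rewrite (le_trans (vnormD _ _)) //.
rewrite (le_trans (lerD (lexx _) (le_trans (Kk _) (ler_wpM2l k0 ih)))) //.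
rewrite -{1}(mul1r (vnorm x)) mulrA -mulrDl ler_wpM2r ?vnorm_ge0 //.
by rewrite le_eqVlt; apply/orP; left; apply/eqP; field; rewrite gt_eqF.
Qed.

Lemma neumann_cauchy n m x : (n <= m)%N ->
  vnorm (neumann m x - neumann n x) <= k ^+ n / (1 - k) * vnorm x.
Proof.
elim: n m => [|n ih] [|m] //= nm.
- by rewrite subrr vnorm0 expr0 mul1r mulr_ge0 ?vnorm_ge0 // invr_ge0 subr_ge0 ltW; case/andP: k01.
- by rewrite subr0 expr0 mul1r; exact: (neumann_bound m.+1).
rewrite opprD addrACA subrr add0r -linB // (le_trans (Kk _)) //.
by rewrite exprS -!mulrA ler_wpM2l ?mulrA ?ih //; case/andP: k01.
Qed.

(** The geometric series of a strict contraction [K] inverts [1 - K]; here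
    completeness of the space provides the sum. *)
Lemma neumann_inverse : exists2 V, bounded_operator V &
  forall x, V x - K (V x) = x.
Proof.
have [k0 k1] := andP k01; have k1' : 0 < 1 - k by rewrite subr_gt0.
have small d : 0 < d -> exists n, k ^+ n / (1 - k) <= d.
  move=> d0; have := @cvg_geometric R 1 k; rewrite ger0_norm // => /(_ k1).
  move/cvgrPdist_le => /(_ (d * (1 - k))); rewrite mulr_gt0 // => /(_ isT) [n _ h].
  exists n; rewrite ler_pdivrMr //; have := h n (leqnn n).
  by rewrite sub0r normrN /= mul1r ger0_norm // exprn_ge0.
have [V lV hV] := op_limit neumann_lin neumann_cauchy small.
exists V.
  apply/bounded_operatorP; split=> //; exists (1 - k)^-1 => [|x].
    by rewrite invr_ge0 ltW.
  by have := hV 0%N x; rewrite /= subr0 expr0 mul1r.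
move=> x; apply/eqP; rewrite -subr_eq0; apply/eqP/vnorm_eq0/eqP.
rewrite eq_le vnorm_ge0 andbT; apply/ler_addgt0Pl => d d0; rewrite addr0.
have [|n hn] := small (d / (2 * (vnorm x + 1))).
  by rewrite divr_gt0 // mulr_gt0 // ltr_wpDl // vnorm_ge0.
have half_ratio : d / (2 * (vnorm x + 1)) * vnorm x <= d / 2.
  have n1 : 0 < vnorm x + 1 by rewrite ltr_wpDl // vnorm_ge0.
  have -> : d / (2 * (vnorm x + 1)) * vnorm x = d / 2 * (vnorm x / (vnorm x + 1)).
    by field; rewrite gt_eqF.
  by rewrite ler_piMr ?divr_ge0 ?(ltW d0) // ler_pdivrMr // mul1r lerDl.
have e1 : vnorm (V x - neumann n x) <= d / 2.
  apply: le_trans (hV n x) (le_trans _ half_ratio).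
  by rewrite ler_wpM2r ?vnorm_ge0.
have e2 : vnorm (V x - neumann n.+1 x) <= d / 2.
  apply: le_trans (hV n.+1 x) (le_trans _ half_ratio).
  rewrite ler_wpM2r ?vnorm_ge0 // (le_trans _ hn) // exprS -mulrA.
  by rewrite ler_piMl ?(ltW k1) // divr_ge0 ?exprn_ge0 // ltW.
rewrite (_ : _ - _ = (V x - neumann n.+1 x) - K (V x - neumann n x)).
  rewrite (le_trans (vnormB _ _)) // (splitr d) lerD // (le_trans (Kk _)) //.
  by rewrite (le_trans _ e1) // ler_piMl ?vnorm_ge0 // ltW.
by rewrite /= linB // opprB opprD !addrA subrK addrAC.
Qed.

End Neumann.

Definition lower_bound (a : R) T := forall x, a * ip x x <= ip (T x) x.

Lemma lower_bound_inj a P : self_adjoint P -> 0 < a -> lower_bound a P ->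
  injective P.
Proof.
move=> sP a0 aP x y Pxy; apply/eqP; rewrite -subr_eq0; apply/eqP/vnorm_eq0.
have := aP (x - y); rewrite (linB (sa_lin sP)) Pxy subrr ip0l pmulr_rle0 //.
rewrite ipxx // => h; apply/eqP; rewrite -sqrf_eq0 eq_le h.
by rewrite exprn_ge0 // vnorm_ge0.
Qed.

(** With [c] above the upper bound of [P], the operator [1 - P / c] is a
    strict contraction, so the Neumann series inverts [P / c]. *)
Lemma lower_bound_inv a P : self_adjoint P -> 0 < a -> lower_bound a P ->
  op_invertible P.
Proof.
move=> sP a0 aP; have [b b0 hb] := sa_upper Hdot sP.
(* Adding [a] keeps [c] above [a] even on the zero space, where [b] is free. *)
pose c := a + b; have c0 : 0 < c by rewrite addr_gt0.
pose K x := x - (c^-1)%:C *: P x; pose k := 1 - a / c.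
have sK : self_adjoint K by apply: sa_sub; [exact: sa_id|exact: sa_scale].
have k01 : 0 <= k < 1.
  rewrite /k subr_ge0 ler_pdivrMr // mul1r lerDl ltW //=.
  by rewrite gtrDl oppr_lt0 divr_gt0.
have hK x : 0 <= ip (K x) x <= k * ip x x.
  rewrite /K ipDl ipNl ipZl /k mulrBl mul1r; apply/andP; split.
    rewrite subr_ge0 mulrC ler_pdivrMr // (le_trans (ler_norm _)) //.
    rewrite (le_trans (hb x)) // mulrC ler_wpM2l ?ip_ge0 //.
    by rewrite lerDr ltW.
  by rewrite lerD2l lerN2 (mulrC a) -mulrA ler_wpM2l // invr_ge0 ltW.
have [V bV hV] := neumann_inverse (sa_lin sK) k01
   (fun x => sa_norm Hdot x sK (proj1 (andP k01)) hK).
have PV x : P (V ((c^-1)%:C *: x)) = x.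
  have := hV ((c^-1)%:C *: x); rewrite /K opprB addrC subrK.
  move=> /(congr1 (fun y => c%:C *: y)); rewrite !scalerA -rmorphM mulfV ?gt_eqF //.
  by rewrite !scale1r.
apply/op_invP; exists (fun x => V ((c^-1)%:C *: x)); split=> // [|x].
- exact: (bop_comp bV (bop_scale _ (@bop_id _ _))).
- by apply: (lower_bound_inj sP a0 aP); rewrite /= PV.
Qed.

Lemma op_inv_opp T : op_invertible (fun x => - T x) -> op_invertible T.
Proof.
move=> /op_invP[V [bV TV VT]].
apply: (@op_inv_lr T (fun x => V (- x)) (fun x => V (- x))) => [|x|x] //.
- exact: (bop_comp bV (bop_opp (@bop_id _ _))).
- by rewrite -[LHS]opprK TV opprK.
Qed.

(** For real [z] outside the bounds, [T - z] or [z - T] is bounded below. For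
    [z = u + i v] with [v != 0], the product of [T - z] and [T - z^*] is
    [(T - u)^2 + v^2], which is bounded below by [v^2]. *)
Lemma spectrum_bounds a b T z : self_adjoint T -> lower_bound a T ->
  (forall x, ip (T x) x <= b * ip x x) -> spectrum T z ->
  exists2 t : R, z = t%:C & a <= t <= b.
Proof.
move=> sT aT Tb; apply: contra_notP => nz.
case: z nz => u v nz; have [v0|v0] := eqVneq v 0.
  have {nz} : ~~ (a <= u <= b) by apply/negP => h; apply: nz; exists u; rewrite ?v0.
  rewrite negb_and -!ltNge v0 => /orP[ua|bu].
    apply: (@lower_bound_inv (a - u)); [exact: sa_shift|by rewrite subr_gt0|].
    by move=> x; rewrite ipDl ipNl ipZl mulrBl lerD2r.
  apply: op_inv_opp; apply: (@lower_bound_inv (u - b)); last first.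
  - by move=> x; rewrite opprB ipDl ipNl ipZl mulrBl lerD2l lerN2.
  - by rewrite subr_gt0.
  have sU : self_adjoint (fun x => u%:C *: x - T x).
    by apply: sa_sub => //; exact: sa_scale (sa_id _).
  by apply: eq_sa sU => x; rewrite opprB.
pose W x := T x - u%:C *: x; have sW : self_adjoint W by exact: sa_shift.
have lW := sa_lin sW.
pose S x := W (W x) + (v ^+ 2)%:C *: x.
have sS : self_adjoint S.
  apply: sa_add; last exact: sa_scale (sa_id _).
  split=> [|x y]; first exact: bop_comp (sa_bop sW) (sa_bop sW).
  by rewrite !(proj2 sW).
have v2 : 0 < v ^+ 2 by rewrite lt_def sqrf_eq0 v0 sqr_ge0.
have /op_invP[V [bV SV VS]] : op_invertible S.
  apply: (lower_bound_inv sS v2) => x.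
  by rewrite /S ipDl ipZl lerDr (sa_ip sW) ip_ge0.
have iv2 : 'i%C * v%:C * ('i%C * v%:C) = - (v ^+ 2)%:C :> R[i].
  by rewrite mulrACA -expr2 sqr_i mulN1r -rmorphM.
have zE : u +i* v = u%:C + 'i%C * v%:C :> R[i] by exact: complexE.
have Tz x : T x - (u +i* v) *: x = W x - ('i%C * v%:C) *: x.
  by rewrite zE scalerDl opprD addrA.
have fac1 x : T (W x + ('i%C * v%:C) *: x) - (u +i* v) *: (W x + ('i%C * v%:C) *: x) = S x.
  rewrite Tz (linD lW) (linZ lW) (scalerDr _ (W x)) scalerA iv2 scaleNr opprD opprK.
  by rewrite addrA addrK.
have fac2 x : W (T x - (u +i* v) *: x) + ('i%C * v%:C) *: (T x - (u +i* v) *: x) = S x.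
  rewrite !Tz (linB lW) (linZ lW) (scalerBr _ (W x)) scalerA iv2 scaleNr opprK.
  by rewrite addrA subrK.
apply: (@op_inv_lr _ (fun x => V (W x + ('i%C * v%:C) *: x))
                     (fun x => W (V x) + ('i%C * v%:C) *: V x)) => [|x|x].
- apply: (bop_comp bV); apply: bop_add; first exact: sa_bop sW.
  exact: (bop_scale _ (@bop_id _ _)).
- by rewrite fac2 VS.
- by rewrite fac1 SV.
Qed.

End Invertibility.

(** * Polynomials of a symmetric operator *)

Section PolynomialCalculus.
Variables (R : realType) (H : completeNormedModType R[i]).
Variable dot : {dot H for (@Num.conj R[i])}.
Hypothesis Hdot : hilbert_form dot.
Local Open Scope complex_scope.
Implicit Types (T U D P : H -> H) (x y : H) (p q g : {poly R[i]}).
Local Notation ip := (rip dot).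
Local Notation self_adjoint := (self_adjoint dot).

Lemma poly_op_widen n q T x : (size q <= n)%N ->
  poly_op q T x = \sum_(i < n) q`_i *: iter i T x.
Proof.
move=> qn; rewrite /poly_op (big_ord_widen n (fun i => q`_i *: iter i T x)) //.
rewrite big_mkcond /=; apply: eq_bigr => i _.
by case: ltnP => // qi; rewrite nth_default // scale0r.
Qed.

Lemma poly_opD p q T x : poly_op (p + q) T x = poly_op p T x + poly_op q T x.
Proof.
rewrite (poly_op_widen _ _ (size_polyD p q)).
rewrite (poly_op_widen _ _ (leq_maxl (size p) (size q))).
rewrite (poly_op_widen _ _ (leq_maxr (size p) (size q))) -big_split /=.
by apply: eq_bigr => i _; rewrite coefD scalerDl.
Qed.

Lemma poly_opZ c p T x : poly_op (c *: p) T x = c *: poly_op p T x.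
Proof.
rewrite (poly_op_widen _ _ (size_scale_leq c p)) /poly_op scaler_sumr.
by apply: eq_bigr => i _; rewrite coefZ scalerA.
Qed.

Lemma poly_opC c T x : poly_op c%:P T x = c *: x.
Proof.
rewrite (poly_op_widen _ _ (size_polyC_leq1 c)) big_ord1.
by rewrite coefC.
Qed.

Lemma poly_opMX p T x : poly_op (p * 'X) T x = poly_op p T (T x).
Proof.
rewrite (@poly_op_widen (size p).+1); last first.
  by rewrite (leq_trans (size_polyMleq _ _)) // size_polyX addn2.
rewrite big_ord_recl coefMX scale0r add0r /poly_op.
by apply: eq_bigr => i _; rewrite coefMX /= -iterS iterSr.
Qed.

Lemma poly_opX T x : poly_op 'X T x = T x.
Proof. by rewrite -(mul1r 'X) poly_opMX poly_opC scale1r. Qed.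

Lemma poly_opN p T x : poly_op (- p) T x = - poly_op p T x.
Proof. by rewrite -scaleN1r poly_opZ scaleN1r. Qed.

Lemma poly_op0 T x : poly_op 0 T x = 0.
Proof. by rewrite -(polyC0 R[i]) poly_opC scale0r. Qed.

Lemma poly_op_comm p T U : linear U -> (forall x, T (U x) = U (T x)) ->
  forall x, poly_op p T (U x) = U (poly_op p T x).
Proof.
move=> lU TU; elim/poly_ind: p => [|p c ih] x; first by rewrite !poly_op0 (lin0 lU).
by rewrite !poly_opD !poly_opMX !poly_opC TU ih (linD lU) (linZ lU).
Qed.

Lemma poly_opM p q T x : linear T ->
  poly_op (p * q) T x = poly_op p T (poly_op q T x).
Proof.
move=> lT; elim/poly_ind: p q x => [|p c ih] q x; first by rewrite mul0r !poly_op0.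
rewrite mulrDl -mulrA !poly_opD mul_polyC poly_opZ poly_opC poly_opMX.
by rewrite -(commr_polyX q) ih poly_opMX (poly_op_comm q lT (fun=> erefl)).
Qed.

(** [U q(TU) = q(UT) U] for polynomials: the intertwining that later moves a
    power from one side of a product to the other. *)
Lemma poly_op_swap p T U x : linear U ->
  poly_op p (U \o T) (U x) = U (poly_op p (T \o U) x).
Proof.
move=> lU; elim/poly_ind: p x => [|p c ih] x; first by rewrite !poly_op0 (lin0 lU).
by rewrite !poly_opD !poly_opMX !poly_opC (linD lU) (linZ lU) -ih.
Qed.

Lemma poly_op_bop p T : bounded_operator T -> bounded_operator (poly_op p T).
Proof.
move=> bT; elim/poly_ind: p => [|p c ih].
  by apply: eq_bop (bop_scale 0 (@bop_id R H)) => x; rewrite poly_op0 scale0r.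
apply: eq_bop (bop_add (bop_comp ih bT) (bop_scale c (@bop_id R H))) => x.
by rewrite poly_opD poly_opMX poly_opC.
Qed.

Definition conj_poly p := map_poly (@Num.conj R[i]) p.

Lemma poly_op_adjoint p T x y : self_adjoint T ->
  dot (poly_op p T x) y = dot x (poly_op (conj_poly p) T y).
Proof.
move=> sT; have lT := sa_lin sT; elim/poly_ind: p x y => [|p c ih] x y.
  by rewrite /conj_poly rmorph0 !poly_op0 dot0l dot0r.
rewrite /conj_poly rmorphD rmorphM /= map_polyX map_polyC /=.
rewrite !poly_opD !poly_opMX !poly_opC dotDl dotDr dotZl dotZr ih (proj2 sT).
by rewrite (poly_op_comm _ lT (fun=> erefl)) conjCK.
Qed.

(** Over the algebraically closed field of scalars [g] is a product of linear
    factors, each of which becomes invertible. *)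
Lemma poly_op_inv T g : bounded_operator T -> g != 0 ->
  (forall z, root g z -> op_invertible (fun x => T x - z *: x)) ->
  op_invertible (poly_op g T).
Proof.
move=> bT g0 hg; have [r gE] := closed_field_poly_normal g.
have lT := bop_lin bT.
have hr z : z \in r -> op_invertible (fun x => T x - z *: x).
  move=> zr; apply: hg; rewrite gE rootZ ?lead_coef_eq0 //.
  by rewrite root_prod_XsubC.
have lg : lead_coef g != 0 by rewrite lead_coef_eq0.
rewrite gE; elim: r hr {gE} => [|z r ih] hr.
  apply: eq_inv (op_inv_scale H lg) => x.
  by rewrite big_nil poly_opZ -(polyC1 R[i]) poly_opC scale1r.
have ihr : op_invertible (poly_op (lead_coef g *: \prod_(z <- r) ('X - z%:P)) T).
  by apply: ih => w wr; apply: hr; rewrite in_cons wr orbT.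
apply: eq_inv (op_inv_comp (hr _ (mem_head _ _)) ihr) => x /=.
by rewrite big_cons scalerAr poly_opM // poly_opD poly_opN poly_opX poly_opC.
Qed.

(** By Cauchy-Schwarz [|D x|^2 <= d <D x, x>], and the inverse bounds [|x|] by
    a multiple of [|D x|]. *)
Lemma nonneg_inv_lower D : self_adjoint D -> (forall x, 0 <= ip (D x) x) ->
  op_invertible D -> exists2 c, 0 < c & lower_bound dot c D.
Proof.
move=> sD pD /op_invP[V [/bop_bound[v v0 hV] DV VD]].
have [d d0 hd] := bop_bound (sa_bop sD).
have hD x : vnorm (D x) ^+ 2 <= d * ip (D x) x.
  have [->|Dx0] := eqVneq (vnorm (D x)) 0.
    by rewrite expr0n mulr_ge0 // ltW.
  have D0 : 0 < vnorm (D x) ^+ 2 by rewrite exprn_gt0 // lt_def Dx0 vnorm_ge0.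
  rewrite -(ler_pM2r D0) -expr2.
  have := form_CS x (D x) (sa_lin sD) (sa_ip sD) pD.
  rewrite ipxx // => /le_trans; apply.
  rewrite [leRHS]mulrAC mulrC ler_wpM2r //.
  rewrite (le_trans (ler_norm _)) // (le_trans (ip_CS Hdot _ _)) //.
  by rewrite expr2 mulrA ler_wpM2r ?vnorm_ge0.
exists (d * v ^+ 2)^-1 => [|x]; first by rewrite invr_gt0 mulr_gt0 // exprn_gt0.
rewrite mulrC ler_pdivrMr; last by rewrite mulr_gt0 // exprn_gt0.
rewrite ipxx // -{1}(VD x) (le_trans (y := (v * vnorm (D x)) ^+ 2)) //.
  by rewrite ler_pXn2r ?nnegrE ?mulr_ge0 ?vnorm_ge0 // ltW.
by rewrite exprMn [leRHS]mulrC -[leRHS]mulrA [leRHS]mulrCA ler_wpM2l ?exprn_ge0 ?(ltW v0).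
Qed.

(** If [<g(T) x, x>] had a negative infimum [m], then [g(T) - m] would be
    nonnegative and, as [g - m] has no root in the spectrum, invertible; so it
    would be bounded below, contradicting the choice of [m]. *)
Lemma poly_nonneg_nonconst T g : self_adjoint T -> self_adjoint (poly_op g T) ->
  (forall c, g != c%:P) -> (forall z, spectrum T z -> 0 <= g.[z]) ->
  forall x, 0 <= ip (poly_op g T x) x.
Proof.
move=> sT sg gc pg; apply: bottom_principle => // m m0 hm.
have hE x : poly_op g T x - m%:C *: x = poly_op (g - m%:C%:P) T x.
  by rewrite poly_opD poly_opN poly_opC.
have sD : self_adjoint (poly_op (g - m%:C%:P) T).
  exact: eq_sa (sa_shift m sg).
have [||c c0 hc] := nonneg_inv_lower sD.
- by move=> x; rewrite -hE ipDl ipNl ipZl subr_ge0.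
- apply: poly_op_inv; [exact: sa_bop sT|by rewrite subr_eq0; exact: gc|move=> z].
  rewrite /root hornerD hornerN hornerC subr_eq0 => /eqP gz.
  by apply: contrapT => /pg; rewrite gz ler0c leNgt m0.
exists c => // x; have := hc x; rewrite -hE ipDl ipNl ipZl mulrDl.
by rewrite lerBrDl addrC.
Qed.

(** Without spectrum, [T - k] is nonnegative for every real [k]. This happens on
    the zero space, which the definition of a Hilbert space allows. *)
Lemma spectrum_empty T : self_adjoint T -> (forall z, ~ spectrum T z) ->
  forall x : H, x = 0.
Proof.
move=> sT s0 x; have [b b0 hb] := sa_upper Hdot sT.
have := @poly_nonneg_nonconst T ('X - (b + 1)%:C%:P) sT _ _ _ x.
have E y : poly_op ('X - (b + 1)%:C%:P) T y = T y - (b + 1)%:C *: y.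
  by rewrite poly_opD poly_opN poly_opX poly_opC.
rewrite E ipDl ipNl ipZl; move=> /(_ _ _ _)-h.
apply: vnorm_eq0; apply/eqP; rewrite -sqrf_eq0 -(ipxx Hdot) eq_le ip_ge0 // andbT.
have : 0 <= ip (T x) x - (b + 1) * ip x x.
  apply: h => [|c|z /s0 //].
  - by apply: eq_sa (sa_shift (b + 1) sT) => y; rewrite E.
  - apply/eqP => /(congr1 (fun p : {poly R[i]} => size p)).
    by rewrite size_XsubC size_polyC; case: (_ != _).
by have := le_trans (ler_norm _) (hb x); lra.
Qed.

Lemma poly_nonneg T g : self_adjoint T -> self_adjoint (poly_op g T) ->
  (forall z, spectrum T z -> 0 <= g.[z]) ->
  forall x, 0 <= ip (poly_op g T x) x.
Proof.
move=> sT sg pg x.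
(* A negative constant has no root: only a point of the spectrum excludes it. *)
have [[c gE]|gc] := pselect (exists c, g = c%:P); last first.
  by apply: poly_nonneg_nonconst => // c; apply/eqP => h; apply: gc; exists c.
have [[z sz]|s0] := pselect (exists z, spectrum T z); last first.
  rewrite (spectrum_empty sT (fun z h => s0 (ex_intro _ z h)) x).
  by rewrite (lin0 (sa_lin sg)) ip0l.
have := pg _ sz; rewrite gE hornerC poly_opC => c0.
have -> : c = (complex.Re c)%:C by rewrite RRe_real // ger0_real.
by rewrite ipZl mulr_ge0 ?ip_ge0 //; move: c0; rewrite lecE /= => /andP[].
Qed.

(** With [q'] the polynomial with conjugate coefficients, [e^2 - q' q] is
    nonnegative on the spectrum, which is real, and the form of its value at [T]
    is [e^2 |x|^2 - |q(T) x|^2]. *)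
Lemma poly_op_norm T q (e : R) a b : self_adjoint T -> lower_bound dot a T ->
  (forall x, ip (T x) x <= b * ip x x) -> 0 <= e ->
  (forall z, spectrum T z -> `|q.[z]| <= e%:C) ->
  forall x, vnorm (poly_op q T x) <= e * vnorm x.
Proof.
move=> sT aT Tb e0 he x; have lT := sa_lin sT.
pose g := (e ^+ 2)%:C%:P - conj_poly q * q.
have gE y : poly_op g T y = (e ^+ 2)%:C *: y - poly_op (conj_poly q) T (poly_op q T y).
  by rewrite poly_opD poly_opN poly_opM // poly_opC.
have qq y z : dot (poly_op (conj_poly q) T (poly_op q T y)) z =
    dot (poly_op q T y) (poly_op q T z).
  by rewrite dotC -poly_op_adjoint // -dotC.
have sQ : self_adjoint (poly_op (conj_poly q) T \o poly_op q T).
  split=> [|y z /=]; first exact: bop_comp (poly_op_bop _ (sa_bop sT)) (poly_op_bop _ (sa_bop sT)).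
  by rewrite qq [RHS]dotC qq -dotC.
have sg : self_adjoint (poly_op g T).
  by apply: eq_sa (sa_sub (sa_scale (e ^+ 2) (sa_id _)) sQ) => y; rewrite gE.
have qqx : ip (poly_op (conj_poly q) T (poly_op q T x)) x = vnorm (poly_op q T x) ^+ 2.
  by rewrite /rip qq -(ipxx Hdot).
rewrite -(ler_pXn2r (n := 2)) ?nnegrE ?mulr_ge0 ?vnorm_ge0 // exprMn.
rewrite -subr_ge0 -qqx -(ipxx Hdot x) -ipZl -ipNl -ipDl -gE.
apply: poly_nonneg => // z sz.
have [t zE tab] := spectrum_bounds Hdot sT aT Tb sz.
rewrite hornerD hornerN hornerM hornerC subr_ge0.
have -> : (conj_poly q).[z] = (q.[z])^*.
  rewrite -horner_map /= zE; congr (_.[_]); apply/eqP.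
  by rewrite eq_complex /= oppr0 !eqxx.
rewrite mulrC -sqr_normc rmorphXn /= ler_pXn2r ?nnegrE ?he //.
by rewrite ler0c.
Qed.

End PolynomialCalculus.

(** * Polynomial approximation of real powers *)

Section Approximation.
Variable R : realType.
Implicit Types (a b c e s t u v x y : R) (f g : R -> R).

(** The Bernstein polynomial of [g] at the nodes [0, ..., n], by the recursion
    of a Bernoulli walk with success probability ['X]. *)
Fixpoint bernstein n (g : nat -> R) : {poly R} :=
  if n is n'.+1
  then 'X * bernstein n' (g \o succn) + (1 - 'X) * bernstein n' g
  else (g 0%N)%:P.

(** [n t (1 - t) + (n t - c)^2] is the second moment about [c] of the walk
    after [n] steps, so this is Chebyshev's estimate for Bernstein's proof of
    the Weierstrass theorem. *)
Lemma bernstein_moment n (g : nat -> R) t v al be c : 0 <= t <= 1 ->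
  (forall k, (k <= n)%N -> `|g k - v| <= al + be * (k%:R - c) ^+ 2) ->
  `|(bernstein n g).[t] - v| <= al + be * (n%:R * (t * (1 - t)) + (n%:R * t - c) ^+ 2).
Proof.
move=> /andP[t0 t1]; have t1' : 0 <= 1 - t by rewrite subr_ge0.
elim: n g c => [|n ih] g c hg.
  by rewrite hornerC !mul0r add0r; exact: hg.
have h1 := ih (g \o succn) (c - 1).
have h0 := ih g c (fun k kn => hg k (leqW kn)).
have -> : (bernstein n.+1 g).[t] = t * (bernstein n (g \o succn)).[t] +
    (1 - t) * (bernstein n g).[t] by rewrite /= !hornerE.
set p1 := (bernstein n (g \o succn)).[t] in h1 *.
set p0 := (bernstein n g).[t] in h0 *.
have -> : t * p1 + (1 - t) * p0 - v = t * (p1 - v) + (1 - t) * (p0 - v) by ring.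
rewrite (le_trans (ler_normD _ _)) // !normrM (ger0_norm t0) (ger0_norm t1').
have {}h1 : `|p1 - v| <=
    al + be * (n%:R * (t * (1 - t)) + (n%:R * t - (c - 1)) ^+ 2).
  apply: h1 => k kn; have := hg k.+1 kn.
  by rewrite -natr1 (_ : k%:R + 1 - c = k%:R - (c - 1)) //; ring.
rewrite (le_trans (lerD (ler_wpM2l t0 h1) (ler_wpM2l t1' h0))) //.
by rewrite le_eqVlt -natr1; apply/orP; left; apply/eqP; ring.
Qed.

Definition approximable a b f := forall e, 0 < e ->
  exists q : {poly R}, forall t, a <= t <= b -> `|q.[t] - f t| <= e.

Definition lipschitz_on a b f (L : R) := forall x y,
  a <= x <= b -> a <= y <= b -> `|f x - f y| <= L * `|x - y|.

Lemma lipschitz_approximable a b f L : a < b -> lipschitz_on a b f L ->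
  approximable a b f.
Proof.
move=> ab fL e e0.
wlog L0 : L fL / 0 < L.
  apply; last exact: (ltr_wpDl (normr_ge0 L) ltr01).
  move=> x y hx hy; rewrite (le_trans (fL _ _ hx hy)) // ler_wpM2r //.
  by rewrite (le_trans (ler_norm _)) // lerDl.
have d0 : 0 < b - a by rewrite subr_gt0.
pose C := L * (b - a); have C0 : 0 < C by rewrite mulr_gt0.
have [n n0 hn] : exists2 n, 0 < n%:R :> R & C ^+ 2 <= n%:R * e ^+ 2.
  exists (Num.truncn (C ^+ 2 / e ^+ 2)).+1; first by rewrite ltr0n.
  by rewrite -ler_pdivrMr ?exprn_gt0 //; apply: ltW; exact: truncnS_gt.
pose g k := f (a + (b - a) * (k%:R / n%:R)).
exists (bernstein n g \Po ((b - a)^-1%:P * ('X - a%:P))) => t /andP[a_t tb].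
rewrite horner_comp !hornerE; set u := (b - a)^-1 * (t - a).
have u01 : 0 <= u <= 1.
  rewrite /u mulr_ge0 ?subr_ge0 ?invr_ge0 ?(ltW d0) //=.
  by rewrite mulrC ler_pdivrMr // mul1r lerD2r.
have tE : t = a + (b - a) * u by rewrite /u mulrA mulfV ?gt_eqF // mul1r addrC subrK.
(* [y <= e / 2 + y^2 / (2 e)] turns the Lipschitz bound [y] into a second moment. *)
pose be := C ^+ 2 / (2 * n%:R ^+ 2 * e).
have hb : forall k, (k <= n)%N -> `|g k - f t| <= e / 2 + be * (k%:R - n%:R * u) ^+ 2.
  move=> k kn; rewrite /g.
  have kn1 : 0 <= (k%:R / n%:R : R) <= 1.
    by rewrite divr_ge0 ?ler0n //= ler_pdivrMr // mul1r ler_nat.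
  have hk : a <= a + (b - a) * (k%:R / n%:R) <= b.
    case/andP: kn1 => k0 k1; rewrite lerDl mulr_ge0 ?(ltW d0) //=.
    by rewrite -lerBrDl ler_piMr // ltW.
  have ht : a <= t <= b by rewrite a_t tb.
  rewrite (le_trans (fL _ _ hk ht)) // [in leLHS]tE.
  have -> : a + (b - a) * (k%:R / n%:R) - (a + (b - a) * u) =
      (b - a) / n%:R * (k%:R - n%:R * u) by field; rewrite gt_eqF.
  set w := k%:R - n%:R * u.
  rewrite normrM ger0_norm ?divr_ge0 ?(ltW d0) ?(ltW n0) // mulrA.
  set y := L * ((b - a) / n%:R) * `|w|.
  have -> : be * w ^+ 2 = y ^+ 2 / (2 * e).
    rewrite /y exprMn real_normK ?num_real // /be /C.
    by field; rewrite !gt_eqF.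
  rewrite -subr_ge0.
  have -> : e / 2 + y ^+ 2 / (2 * e) - y = (e - y) ^+ 2 / (2 * e).
    by field; rewrite gt_eqF.
  by rewrite divr_ge0 ?sqr_ge0 // mulr_ge0 // ltW.
rewrite (le_trans (bernstein_moment u01 hb)) // subrr expr0n addr0.
have be0 : 0 <= be.
  by rewrite divr_ge0 ?sqr_ge0 // !mulr_ge0 ?sqr_ge0 // ltW.
case/andP: u01 => u0 u1.
have uu : u * (1 - u) <= 1.
  by rewrite mulr_ile1 ?subr_ge0 // lerBlDr lerDl.
rewrite [leRHS](splitr e) lerD2l (le_trans (y := be * n%:R)) //.
  by rewrite ler_wpM2l // ler_piMr // ltW.
have -> : be * n%:R = C ^+ 2 / n%:R / (2 * e).
  by rewrite /be; field; rewrite !gt_eqF.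
rewrite ler_pdivrMr ?mulr_gt0 // ler_pdivrMr //.
by rewrite (le_trans hn) // le_eqVlt; apply/orP; left; apply/eqP; field.
Qed.

(** Like the bound for [ln] below, it comes from [1 + x <= exp x]. *)
Lemma expR_lipschitz x y : `|expR x - expR y| <= expR (Num.max x y) * `|x - y|.
Proof.
wlog xy : x y / y <= x.
  move=> h; case/orP: (le_total y x) => xy; first exact: h.
  by rewrite distrC (distrC x) maxC; exact: h.
rewrite max_l // !ger0_norm ?subr_ge0 ?ler_expR //.
have -> : expR x - expR y = expR x * (1 - expR (y - x)).
  by rewrite mulrBr mulr1 -expRD (addrC x) subrK.
rewrite ler_wpM2l ?expR_ge0 //.
by have := expR_ge1Dx (y - x); lra.
Qed.

Lemma ln_lipschitz a x y : 0 < a -> a <= x -> a <= y ->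
  `|ln x - ln y| <= a^-1 * `|x - y|.
Proof.
move=> a0; wlog xy : x y / y <= x.
  move=> h ax ay; case/orP: (le_total y x) => xy; first exact: h.
  by rewrite distrC (distrC x); exact: h.
move=> ax ay; have x0 := lt_le_trans a0 ax; have y0 := lt_le_trans a0 ay.
rewrite !ger0_norm ?subr_ge0 ?ler_ln ?posrE //.
rewrite -ln_div ?posrE //.
have -> : x / y = 1 + (x - y) / y by field; rewrite gt_eqF.
rewrite (le_trans (le_ln1Dx _)) //.
  rewrite (lt_le_trans (y := 0)) ?ltrN10 // divr_ge0 ?subr_ge0 //.
  exact: ltW.
by rewrite mulrC ler_wpM2r ?subr_ge0 // lef_pV2 ?posrE.
Qed.

Lemma ln_bound a b t : 0 < a -> a <= t <= b -> `|ln t| <= `|ln a| + `|ln b|.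
Proof.
move=> a0 /andP[at_ tb]; have t0 := lt_le_trans a0 at_; have b0 := lt_le_trans t0 tb.
have l1 : ln a <= ln t by rewrite ler_ln ?posrE.
have l2 : ln t <= ln b by rewrite ler_ln ?posrE.
have := ler_norm (ln b); have := ler_norm (- ln a); rewrite normrN.
have := normr_ge0 (ln a); have := normr_ge0 (ln b).
by move=> ? ? ? ?; rewrite ler_norml; apply/andP; split; lra.
Qed.

Lemma powR_lipschitz a b s : 0 < a -> exists L, lipschitz_on a b (fun t => t `^ s) L.
Proof.
move=> a0; pose M := `|s| * (`|ln a| + `|ln b|).
exists (expR M * (`|s| * a^-1)) => x y hx hy.
have hM z : a <= z <= b -> s * ln z <= M.
  move=> hz; rewrite (le_trans (ler_norm _)) // normrM ler_wpM2l //.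
  exact: ln_bound.
have [ax _] := andP hx; have [ay _] := andP hy.
have x0 := lt_le_trans a0 ax; have y0 := lt_le_trans a0 ay.
rewrite /powR !gt_eqF // (le_trans (expR_lipschitz _ _)) // -mulrA.
apply: ler_pM; rewrite ?expR_ge0 // ?ler_expR ?ge_max ?hM //.
by rewrite -mulrBr normrM -mulrA ler_wpM2l // ln_lipschitz.
Qed.

Lemma powR_approximable a b s : 0 < a -> a < b ->
  approximable a b (fun t => t `^ s).
Proof.
move=> a0 ab; have [L hL] := powR_lipschitz b s a0.
exact: lipschitz_approximable hL.
Qed.

(** Used to pass to the limit in the exponent of an operator inequality. *)
Lemma powR_exponent a b s : 0 < a -> exists2 L, 0 <= L &
  forall u t, `|u - s| <= 1 -> a <= t <= b -> `|t `^ u - t `^ s| <= L * `|u - s|.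
Proof.
move=> a0; pose l := `|ln a| + `|ln b|; pose M := (`|s| + 1) * l.
have l0 : 0 <= l by rewrite addr_ge0.
exists (expR M * l) => [|u t us ht]; first by rewrite mulr_ge0 ?expR_ge0.
have [at_ _] := andP ht; have t0 := lt_le_trans a0 at_.
have hM w : `|w| <= `|s| + 1 -> w * ln t <= M.
  move=> hw; rewrite (le_trans (ler_norm _)) // normrM.
  by rewrite ler_pM // ln_bound.
have hu : `|u| <= `|s| + 1.
  by rewrite -{1}(subrK s u) (le_trans (ler_normD _ _)) // addrC lerD2l.
rewrite /powR !gt_eqF // (le_trans (expR_lipschitz _ _)) // -mulrA.
apply: ler_pM; rewrite ?expR_ge0 // ?ler_expR ?ge_max ?hM ?lerDl //.
by rewrite -mulrBl normrM mulrC ler_wpM2r // ln_bound.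
Qed.

End Approximation.

(** * Continuous functional calculus *)

Section FunctionalCalculus.
Variables (R : realType) (H : completeNormedModType R[i]).
Variable dot : {dot H for (@Num.conj R[i])}.
Hypothesis Hdot : hilbert_form dot.
Local Open Scope complex_scope.
Implicit Types (T U D P X Y : H -> H) (x y : H) (p q : {poly R}).
Implicit Types (f g : R -> R) (a b c s t : R).
Local Notation ip := (rip dot).
Local Notation self_adjoint := (self_adjoint dot).

Lemma le_small (u v c : R) : 0 <= c -> (forall d, 0 < d -> u <= v + d * c) -> u <= v.
Proof.
move=> c0 h; apply/ler_addgt0Pr => e e0.
have c1 : 0 < c + 1 by rewrite ltr_wpDl.
rewrite (le_trans (h (e / (c + 1)) (divr_gt0 e0 c1))) // lerD2l.
by rewrite mulrAC ler_pdivrMr // ler_wpM2l ?lerDl // ltW.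
Qed.

Lemma vnorm_small x c : 0 <= c -> (forall d, 0 < d -> vnorm x <= d * c) -> x = 0.
Proof.
move=> c0 h; apply: vnorm_eq0; apply/eqP; rewrite eq_le vnorm_ge0 andbT.
by apply: (le_small c0) => d /h; rewrite add0r.
Qed.

Lemma vnorm_dist y x z : vnorm (x - z) <= vnorm (x - y) + vnorm (y - z) :> R.
Proof. by rewrite -{1}(subrK y x) -addrA; exact: vnormD. Qed.

Lemma vnorm_distC x y : vnorm (x - y) = vnorm (y - x).
Proof. by rewrite -opprB vnormN. Qed.

Definition between a b T := [/\ self_adjoint T, lower_bound dot a T &
  forall x, ip (T x) x <= b * ip x x].

Lemma between_widen a b a' b' T : between a b T -> a' <= a -> b <= b' ->
  between a' b' T.
Proof.
move=> [sT aT Tb] aa bb; split=> // x.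
  by rewrite (le_trans _ (aT x)) // ler_wpM2r ?ip_ge0.
by rewrite (le_trans (Tb x)) // ler_wpM2r ?ip_ge0.
Qed.

Lemma posdef_between T : posdef dot T ->
  exists a b, [/\ 0 < a, a < b & between a b T].
Proof.
move=> [/op_nonnegP[sT pT] iT]; have [a a0 aT] := nonneg_inv_lower Hdot sT pT iT.
have [b b0 hb] := sa_upper Hdot sT.
exists a, (a + b); split=> //; first by rewrite ltrDl.
split=> // x; rewrite (le_trans (ler_norm _)) // (le_trans (hb x)) //.
by rewrite ler_wpM2r ?ip_ge0 // lerDr ltW.
Qed.

Definition rpoly p : {poly R[i]} := map_poly (real_complex R) p.

Lemma rpoly_horner p t : (rpoly p).[t%:C] = (p.[t])%:C.
Proof. exact: horner_map. Qed.

Definition rpoly_op p T := poly_op (rpoly p) T.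

Lemma rpoly_sa p T : self_adjoint T -> self_adjoint (rpoly_op p T).
Proof.
move=> sT; split=> [|x y]; first exact: poly_op_bop (sa_bop sT).
rewrite poly_op_adjoint //; congr (dot _ (poly_op _ _ _)).
apply/polyP => i; rewrite !coef_map /=; apply/eqP.
by rewrite eq_complex /= oppr0 !eqxx.
Qed.

Section Interval.
Variables (a b : R) (T : H -> H).
Hypothesis abT : between a b T.

Let sT : self_adjoint T. Proof. by case: abT. Qed.
Let lT : linear T. Proof. exact: sa_lin sT. Qed.

Lemma rpoly_opB p q x : rpoly_op (p - q) T x = rpoly_op p T x - rpoly_op q T x.
Proof. by rewrite /rpoly_op /rpoly rmorphB /= poly_opD poly_opN. Qed.

Lemma rpoly_norm p c x : 0 <= c -> (forall t, a <= t <= b -> `|p.[t]| <= c) ->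
  vnorm (rpoly_op p T x) <= c * vnorm x.
Proof.
move=> c0 hp; have [_ aT Tb] := abT.
apply: (poly_op_norm Hdot sT aT Tb c0) => z /(spectrum_bounds Hdot sT aT Tb)[t -> tab].
by rewrite rpoly_horner norm_normc normc_real lecR hp.
Qed.

(** [X] is [f(T)]: polynomials near [f] on the interval give operators near
    [X], with the same precision. Stated for all polynomials rather than for a
    sequence, it makes sums, products and compositions direct estimates. *)
Record calculus f X : Prop := Calculus {
  calc_approx : approximable a b f;
  calc_fun_bound : exists2 F, 0 <= F & forall t, a <= t <= b -> `|f t| <= F;
  calc_bop : bounded_operator X;
  calc_spec : forall p c, 0 <= c -> (forall t, a <= t <= b -> `|p.[t] - f t| <= c) ->
    forall x, vnorm (rpoly_op p T x - X x) <= c * vnorm x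
}.

Lemma calculus_exists f : approximable a b f ->
  (exists2 F, 0 <= F & forall t, a <= t <= b -> `|f t| <= F) ->
  exists X, calculus f X.
Proof.
move=> af bf.
have /choice[p hp] : forall n : nat, exists p, forall t, a <= t <= b ->
    `|p.[t] - f t| <= n.+1%:R^-1 by move=> n; apply: af; rewrite invr_gt0 ltr0n.
have e0 n : 0 <= n.+1%:R^-1 :> R by rewrite invr_ge0.
have pp n m x : (n <= m)%N -> vnorm (rpoly_op (p m) T x - rpoly_op (p n) T x)
    <= 2 * n.+1%:R^-1 * vnorm x.
  move=> nm; rewrite -rpoly_opB; apply: rpoly_norm => [|t ht].
    by rewrite mulr_ge0.
  rewrite hornerD hornerN -(subrKA (f t)) (le_trans (ler_normD _ _)) //.
  rewrite mulr_natl mulr2n lerD //; last by rewrite distrC hp.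
  by rewrite (le_trans (hp m t ht)) // lef_pV2 ?posrE ?ltr0n // ler_nat.
have small d : 0 < d -> exists n, 2 * n.+1%:R^-1 <= d :> R.
  move=> d0; exists (Num.truncn (2 / d)).
  by rewrite ler_pdivrMr ?ltr0n // mulrC -ler_pdivrMr // ltW // truncnS_gt.
have [X lX hX] := op_limit (fun n => sa_lin (rpoly_sa (p n) sT)) pp small.
exists X; split=> //.
  apply/bounded_operatorP; split=> //.
  have [c c0 hc] := bop_bound (sa_bop (rpoly_sa (p 0%N) sT)).
  exists (2 * 1%:R^-1 + c) => [|x]; first by rewrite addr_ge0 ?mulr_ge0 // ltW.
  rewrite -{1}(subrK (rpoly_op (p 0%N) T x) (X x)) (le_trans (vnormD _ _)) //.
  by rewrite mulrDl lerD //; exact: hX.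
move=> q c c0 hq x; apply: (le_small (vnorm_ge0 x)) => d d0.
have [|n hn] := small (d / 2); first by rewrite divr_gt0.
rewrite (le_trans (vnorm_dist (rpoly_op (p n) T x) _ _)) //.
rewrite (_ : _ + d * _ = (c + d / 2) * vnorm x + d / 2 * vnorm x); last by field.
rewrite lerD //.
  rewrite -rpoly_opB; apply: rpoly_norm => [|t ht].
    by rewrite addr_ge0 // ltW // divr_gt0.
  rewrite hornerD hornerN -(subrKA (f t)) (le_trans (ler_normD _ _)) //.
  rewrite lerD ?hq // distrC (le_trans (hp n t ht)) // (le_trans _ hn) //.
  by rewrite ler_peMl // ler1n.
by rewrite vnorm_distC (le_trans (hX n x)) // ler_wpM2r ?vnorm_ge0.
Qed.

(** With [f = g] this is uniqueness; with two powers it is continuity in the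
    exponent. *)
Lemma calculus_dist f g X Y c : calculus f X -> calculus g Y -> 0 <= c ->
  (forall t, a <= t <= b -> `|f t - g t| <= c) ->
  forall x, vnorm (X x - Y x) <= c * vnorm x.
Proof.
move=> fX gY c0 fg x.
apply: (@le_small _ _ (2 * vnorm x)) => [|d d0]; first by rewrite mulr_ge0 ?vnorm_ge0.
have [p hp] := calc_approx fX d0; have d0' := ltW d0.
rewrite (le_trans (vnorm_dist (rpoly_op p T x) _ _)) // vnorm_distC.
rewrite (_ : c * _ + _ = d * vnorm x + (c + d) * vnorm x); last by ring.
rewrite lerD ?(calc_spec fX) // (calc_spec gY) ?addr_ge0 // => t ht.
rewrite -(subrKA (f t)) (le_trans (ler_normD _ _)) // addrC.
by rewrite lerD ?hp ?fg.
Qed.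

Lemma calculus_uniq f X Y : calculus f X -> calculus f Y -> X = Y.
Proof.
move=> fX fY; apply: funext => x; apply/eqP; rewrite -subr_eq0; apply/eqP.
apply: (vnorm_small (vnorm_ge0 x)) => d d0.
apply: (calculus_dist fX fY (ltW d0)) => t ht.
by rewrite subrr normr0 ltW.
Qed.

Lemma calculus_ext f g X : calculus f X ->
  (forall t, a <= t <= b -> f t = g t) -> calculus g X.
Proof.
move=> [af [F F0 bf] bX sX] fg; split=> // [e e0||p c c0 hp].
- by have [p hp] := af e e0; exists p => t ht; rewrite -fg // hp.
- by exists F => // t ht; rewrite -fg // bf.
- by apply: sX => // t ht; rewrite fg // hp.
Qed.

Lemma calculus_sa f X : calculus f X -> self_adjoint X.
Proof.
move=> fX; apply: sa_of_ip => [|x y]; first exact: calc_bop fX.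
apply/eqP; rewrite -subr_eq0 -normr_le0.
apply: (@le_small _ _ (2 * (vnorm x * vnorm y))) => [|d d0].
  by rewrite !mulr_ge0 ?vnorm_ge0.
have [p hp] := calc_approx fX d0; have hX := calc_spec fX (ltW d0) hp.
have -> : ip (X x) y - ip x (X y) =
    ip x (rpoly_op p T y - X y) - ip (rpoly_op p T x - X x) y.
  rewrite ipDl ipDr ipNl ipNr (sa_ip (rpoly_sa p sT)); lra.
rewrite (le_trans (ler_normB _ _)) // add0r.
rewrite (le_trans (lerD (ip_CS Hdot _ _) (ip_CS Hdot _ _))) //.
have := ler_wpM2l (vnorm_ge0 x) (hX y); have := ler_wpM2r (vnorm_ge0 y) (hX x).
by lra.
Qed.

Lemma calculus_const c : calculus (fun=> c) (fun x => c%:C *: x).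
Proof.
have cE x : rpoly_op c%:P T x = c%:C *: x.
  by rewrite /rpoly_op /rpoly map_polyC poly_opC.
split=> [e e0|||p e e0 hp x].
- by exists c%:P => t _; rewrite hornerC subrr normr0 ltW.
- by exists `|c|.
- exact: bop_scale _ (@bop_id R H).
- rewrite -cE -rpoly_opB; apply: rpoly_norm => // t ht.
  by rewrite hornerD hornerN hornerC hp.
Qed.

Lemma calculus_id : calculus id T.
Proof.
have XE x : rpoly_op 'X T x = T x.
  by rewrite /rpoly_op /rpoly map_polyX poly_opX.
split=> [e e0|||p e e0 hp x].
- by exists 'X => t _; rewrite hornerX subrr normr0 ltW.
- exists (`|a| + `|b|) => [|t /andP[a_t tb]]; first by rewrite addr_ge0.
  have := ler_norm b; have := ler_norm (- a); rewrite normrN.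
  have := normr_ge0 a; have := normr_ge0 b.
  by move=> ? ? ? ?; rewrite ler_norml; apply/andP; split; lra.
- exact: sa_bop sT.
- rewrite -XE -rpoly_opB; apply: rpoly_norm => // t ht.
  by rewrite hornerD hornerN hornerX hp.
Qed.

(** One step of Horner's scheme; products and polynomials of [X] follow. *)
Lemma calculus_mulD f g X Y c : calculus f X -> calculus g Y ->
  calculus (fun t => f t * g t + c) (fun x => X (Y x) + c%:C *: x).
Proof.
move=> fX gY; have [F F0 hF] := calc_fun_bound fX; have [G G0 hG] := calc_fun_bound gY.
have near_fg d p q : 0 < d -> d <= 1 ->
    (forall t, a <= t <= b -> `|p.[t] - f t| <= d) ->
    (forall t, a <= t <= b -> `|q.[t] - g t| <= d) ->
    forall t, a <= t <= b ->
    `|(p * q + c%:P).[t] - (f t * g t + c)| <= d * (F + G + 1).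
  move=> d0 d1 hp hq t ht; rewrite hornerD hornerM hornerC.
  have -> : p.[t] * q.[t] + c - (f t * g t + c) =
    (p.[t] - f t) * (q.[t] - g t) + f t * (q.[t] - g t) + g t * (p.[t] - f t) by ring.
  rewrite (le_trans (ler_normD _ _)) // (_ : d * _ = d + F * d + G * d); last by ring.
  rewrite lerD //; last by rewrite normrM ler_pM ?hG ?hp.
  rewrite (le_trans (ler_normD _ _)) // lerD //; last by rewrite normrM ler_pM ?hF ?hq.
  rewrite normrM -[leRHS]mulr1; apply: ler_pM; rewrite ?hp //.
  exact: le_trans (hq _ ht) d1.
have FG : 0 < F + G + 1 by rewrite ltr_wpDl // addr_ge0.
have bXY : bounded_operator (fun x => X (Y x) + c%:C *: x).
  apply: bop_add; last exact: bop_scale _ (@bop_id R H).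
  exact: bop_comp (calc_bop fX) (calc_bop gY).
split=> // [e e0||r e e0 hr x].
- pose d := Num.min 1 (e / (F + G + 1)).
  have d0 : 0 < d by rewrite lt_min ltr01 divr_gt0.
  have [p hp] := calc_approx fX d0; have [q hq] := calc_approx gY d0.
  exists (p * q + c%:P) => t ht; rewrite (le_trans (near_fg d p q _ _ hp hq t ht)) //.
    by rewrite ge_min lexx.
  by rewrite -ler_pdivlMr // ge_min lexx orbT.
- exists (F * G + `|c|) => [|t ht]; first by rewrite addr_ge0 ?mulr_ge0.
  by rewrite (le_trans (ler_normD _ _)) // lerD // normrM ler_pM ?hF ?hG.
have [cX cX0 hcX] := bop_bound (calc_bop fX); have [cY cY0 hcY] := bop_bound (calc_bop gY).
apply: (@le_small _ _ ((F + G + 1 + (cX + 1) + cY) * vnorm x)) => [|d' d0'].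
  by rewrite mulr_ge0 ?vnorm_ge0 // !addr_ge0 // ltW.
pose d := Num.min 1 d'; have d0 : 0 < d by rewrite lt_min ltr01.
have d1 : d <= 1 by rewrite ge_min lexx.
have dd : d <= d' by rewrite ge_min lexx orbT.
have [p hp] := calc_approx fX d0; have [q hq] := calc_approx gY d0.
have hX := calc_spec fX (ltW d0) hp; have hY := calc_spec gY (ltW d0) hq.
have pqE : rpoly_op (p * q + c%:P) T x = rpoly_op p T (rpoly_op q T x) + c%:C *: x.
  by rewrite /rpoly_op /rpoly rmorphD rmorphM /= map_polyC poly_opD poly_opC poly_opM.
rewrite (le_trans (vnorm_dist (rpoly_op (p * q + c%:P) T x) _ _)) //.
apply: (le_trans (y := (e + d * (F + G + 1)) * vnorm x +
   (d * (cX + 1) * vnorm x + d * cY * vnorm x))); last first.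
  rewrite -subr_ge0 (_ : _ - _ = (d' - d) * ((F + G + 1 + (cX + 1) + cY) * vnorm x)).
    by rewrite mulr_ge0 ?subr_ge0 // mulr_ge0 ?vnorm_ge0 // !addr_ge0 // ltW.
  by ring.
rewrite lerD //.
  rewrite -rpoly_opB; apply: rpoly_norm => [|t ht].
    by rewrite addr_ge0 // mulr_ge0 // ltW.
  rewrite hornerD hornerN -(subrKA (f t * g t + c)) (le_trans (ler_normD _ _)) //.
  by rewrite lerD ?hr // distrC; exact: near_fg.
rewrite pqE opprD addrACA subrr addr0.
rewrite (le_trans (vnorm_dist (rpoly_op p T (Y x)) _ _)) // lerD //.
  rewrite -(linB (sa_lin (rpoly_sa p sT))).
  rewrite -{1}(subrK (X (rpoly_op q T x - Y x)) (rpoly_op p T _)).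
  rewrite (le_trans (vnormD _ _)) //.
  have dc : 0 <= d + cX by rewrite addr_ge0 ?(ltW d0) ?(ltW cX0).
  rewrite (le_trans (lerD (hX _) (hcX _))) // -mulrDl.
  rewrite (le_trans (ler_wpM2l dc (hY x))) // mulrCA -(mulrA d (cX + 1)).
  rewrite ler_wpM2l ?(ltW d0) // ler_wpM2r ?vnorm_ge0 //.
  by rewrite addrC lerD2l.
rewrite (le_trans (hX _)) // -mulrA ler_wpM2l ?(ltW d0) //.
Qed.

Lemma calculus_mul f g X Y : calculus f X -> calculus g Y ->
  calculus (fun t => f t * g t) (X \o Y).
Proof.
move=> fX gY; have := calculus_mulD 0 fX gY.
have -> : (fun x => X (Y x) + 0%:C *: x) = X \o Y.
  by apply: funext => x; rewrite scale0r addr0.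
by move=> h; apply: calculus_ext h _ => t _; rewrite addr0.
Qed.

Lemma calculus_poly p f X : calculus f X ->
  calculus (fun t => p.[f t]) (rpoly_op p X).
Proof.
move=> fX; elim/poly_ind: p => [|p c ih].
  have -> : rpoly_op 0 X = (fun x => 0%:C *: x).
    by apply: funext => x; rewrite /rpoly_op /rpoly rmorph0 poly_op0 scale0r.
  by apply: calculus_ext (calculus_const 0) _ => t _; rewrite horner0.
have -> : rpoly_op (p * 'X + c%:P) X = (fun x => rpoly_op p X (X x) + c%:C *: x).
  apply: funext => x; rewrite /rpoly_op /rpoly rmorphD rmorphM /= map_polyX map_polyC.
  by rewrite poly_opD poly_opMX poly_opC.
by apply: calculus_ext (calculus_mulD c ih fX) _ => t _; rewrite !hornerE.
Qed.

End Interval.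
End FunctionalCalculus.

(** * Real powers of positive definite operators *)

Section OperatorPowers.
Variables (R : realType) (H : completeNormedModType R[i]).
Variable dot : {dot H for (@Num.conj R[i])}.
Hypothesis Hdot : hilbert_form dot.
Local Open Scope classical_set_scope.
Local Open Scope ring_scope.
Local Open Scope complex_scope.
Implicit Types (T U P X Y : H -> H) (x y : H) (a b c s t : R).
Local Notation ip := (rip dot).
Local Notation self_adjoint := (self_adjoint dot).
Local Notation posdef := (posdef dot).
Local Notation between := (between dot).

Lemma powR_bounded a b s : 0 < a ->
  exists2 F, 0 <= F & forall t, a <= t <= b -> `|t `^ s| <= F.
Proof.
move=> a0; exists (expR (`|s| * (`|ln a| + `|ln b|))) => [|t ht]; first exact: expR_ge0.
have t0 : 0 < t by case/andP: ht => /(lt_le_trans a0).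
rewrite ger0_norm ?powR_ge0 // /powR gt_eqF // ler_expR.
by rewrite (le_trans (ler_norm _)) // normrM ler_wpM2l // ln_bound.
Qed.

(** The power exists, and any two limits of polynomials that converge on the
    spectrum agree, so the choice in [oppow] returns the expected operator. *)
Lemma oppow_calculus a b T s : 0 < a -> a < b -> between a b T ->
  calculus a b T (fun t => t `^ s) (oppow T s).
Proof.
move=> a0 ab abT; have [sT aT Tb] := abT.
have af := powR_approximable s a0 ab.
have [X fX] := calculus_exists Hdot abT af (powR_bounded b s a0).
suff -> : oppow T s = X by [].
have inv_small (e : R) : 0 < e -> \forall n \near \oo, n.+1%:R^-1 <= e.
  move=> e0; exists (Num.truncn e^-1) => // n /= hn.
  rewrite -[leRHS]invrK lef_pV2 ?posrE ?invr_gt0 ?ltr0n //.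
  by rewrite (le_trans (ltW (truncnS_gt _))) // ler_nat.
have PX : is_functional_calculus T (fun z => (complex.Re z `^ s)%:C) X.
  split; first exact: calc_bop fX.
  have /choice[p hp] : forall n : nat, exists p : {poly R}, forall t, a <= t <= b ->
    `|p.[t] - t `^ s| <= n.+1%:R^-1 by move=> n; apply: af; rewrite invr_gt0 ltr0n.
  exists (fun n => rpoly (p n)); split=> [e e0|].
    apply: filterS (inv_small e e0) => n ne z.
    move=> /(spectrum_bounds Hdot sT aT Tb)[t -> tab] /=.
    rewrite rpoly_horner -rmorphB norm_normc normc_real lecR.
    by rewrite (le_trans (hp n t tab)).
  apply/cvgr0Pnorm_le => e e0; apply: filterS (inv_small e e0) => n ne.
  have bD : bounded_operator (poly_op (rpoly (p n)) T \- X).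
    apply: bop_sub; last exact: calc_bop fX.
    exact: poly_op_bop (sa_bop sT).
  rewrite ger0_norm ?opnorm_ge0 //; apply: le_trans ne.
  by apply: opnorm_le => [|x]; [rewrite invr_ge0|apply: (calc_spec fX) => //; exact: hp].
rewrite /oppow; have := xgetPex (\0 : H -> H) (ex_intro _ X PX).
set Y := xget _ _ => -[bY [q [hq qY]]].
apply: funext => x; apply/eqP; rewrite -subr_eq0; apply/eqP.
apply: (@vnorm_small _ _ _ (4 * vnorm x)) => [|d d0]; first by rewrite mulr_ge0 ?vnorm_ge0.
have [p hp] := af d d0.
have [n [hn1 hn2]] : exists n, (forall z, spectrum T z ->
    `|(q n).[z] - (complex.Re z `^ s)%:C| <= d%:C) /\
    opnorm (poly_op (q n) T \- Y) <= d.
  have qn := hq d d0.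
  move/cvgr0Pnorm_le : qY => /(_ d d0) qY.
  have [n _ hn] := filterI qn qY.
  exists n; have [h1 h2] := hn n (leqnn n); split=> //.
  by rewrite (le_trans (ler_norm _)).
have bD : bounded_operator (poly_op (q n) T \- Y).
  by apply: bop_sub => //; exact: poly_op_bop (sa_bop sT).
have h1 : vnorm (poly_op (q n) T x - Y x) <= d * vnorm x.
  rewrite (le_trans (opnorm_bound x bD)) // ler_wpM2r ?vnorm_ge0 //.
have h2 := calc_spec fX (ltW d0) hp x.
have h3 : vnorm (poly_op (q n - rpoly p) T x) <= (2 * d) * vnorm x.
  apply: (poly_op_norm Hdot sT aT Tb); first by rewrite mulr_ge0 // ltW.
  move=> z sz; have := hn1 z sz.
  have [t -> tab] := spectrum_bounds Hdot sT aT Tb sz => /= hz.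
  rewrite hornerD hornerN -(subrKA (t `^ s)%:C) (le_trans (ler_normD _ _)) //.
  rewrite rpoly_horner mulr2n mulrDl mul1r rmorphD lerD //.
  by rewrite -rmorphB norm_normc normc_real lecR distrC hp.
rewrite poly_opD poly_opN in h3.
rewrite (le_trans (vnorm_dist (poly_op (q n) T x) _ _)) // vnorm_distC.
have := vnorm_dist (rpoly_op p T x) (poly_op (q n) T x) (X x).
have : 0 <= d * vnorm x by rewrite mulr_ge0 ?vnorm_ge0 // ltW.
by rewrite /rpoly_op in h2 *; lra.
Qed.

Lemma oppow_sa T s : posdef T -> self_adjoint (oppow T s).
Proof.
move=> /(posdef_between Hdot)[a [b [a0 ab abT]]].
exact: calculus_sa (oppow_calculus s a0 ab abT).
Qed.

Lemma oppow_bop T s : posdef T -> bounded_operator (oppow T s).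
Proof. by move=> /oppow_sa /sa_bop. Qed.

Lemma oppowD T s t x : posdef T -> oppow T s (oppow T t x) = oppow T (s + t) x.
Proof.
move=> /(posdef_between Hdot)[a [b [a0 ab abT]]].
have cst := calculus_mul Hdot abT (oppow_calculus s a0 ab abT) (oppow_calculus t a0 ab abT).
rewrite -[LHS]/((oppow T s \o oppow T t) x).
congr (_ x); apply: (calculus_uniq _ (oppow_calculus _ a0 ab abT)).
apply: calculus_ext cst _ => u /andP[au _].
by rewrite powRD //; apply/implyP => _; rewrite gt_eqF // (lt_le_trans a0).
Qed.

Lemma oppow0 T x : posdef T -> oppow T 0 x = x.
Proof.
move=> /(posdef_between Hdot)[a [b [a0 ab abT]]].
have := calculus_const Hdot abT 1; rewrite (_ : (fun y => 1%:C *: y) = @id H).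
  move=> h; rewrite -[RHS]/(id x); congr (_ x).
  apply: (calculus_uniq (oppow_calculus 0 a0 ab abT)).
  by apply: calculus_ext h _ => t _; rewrite powRr0.
by apply: funext => y; rewrite scale1r.
Qed.

Lemma oppow1 T : posdef T -> oppow T 1 = T.
Proof.
move=> /(posdef_between Hdot)[a [b [a0 ab abT]]].
apply: (calculus_uniq (oppow_calculus 1 a0 ab abT)).
apply: calculus_ext (calculus_id Hdot abT) _ => t /andP[at_ _].
by rewrite powRr1 // ltW // (lt_le_trans a0).
Qed.

Lemma oppowNK T s x : posdef T -> oppow T (- s) (oppow T s x) = x.
Proof. by move=> pT; rewrite oppowD // addNr oppow0. Qed.

Lemma oppowKN T s x : posdef T -> oppow T s (oppow T (- s) x) = x.
Proof. by move=> pT; rewrite oppowD // subrr oppow0. Qed.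

Lemma oppow_inv T s : posdef T -> op_invertible (oppow T s).
Proof.
move=> pT; apply/op_invP; exists (oppow T (- s)).
by split=> [|x|x]; [exact: oppow_bop|rewrite oppowKN|rewrite oppowNK].
Qed.

Lemma oppow_half T s x : posdef T -> oppow T (s / 2) (oppow T (s / 2) x) = oppow T s x.
Proof. by move=> pT; rewrite oppowD // -splitr. Qed.

Lemma oppow_posdef T s : posdef T -> posdef (oppow T s).
Proof.
move=> pT; split; last exact: oppow_inv.
apply/op_nonnegP; split=> [|x]; first exact: oppow_sa.
by rewrite -(oppow_half s x pT) (sa_ip (oppow_sa _ pT)) ip_ge0.
Qed.

(** The calculus of [T ^ s] is transported from that of [T] by composition of
    functions. *)
Lemma oppowM T s t : posdef T -> oppow (oppow T s) t = oppow T (s * t).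
Proof.
move=> pT; have [a [b [a0 ab abT]]] := posdef_between Hdot pT.
have [a' [b' [a0' ab' abP]]] := posdef_between Hdot (oppow_posdef s pT).
have cs := oppow_calculus s a0 ab abT.
have [F F0 hF] := powR_bounded b s a0.
have [m m0 hm] : exists2 m, 0 < m & forall u, a <= u <= b -> m <= u `^ s.
  have [G G0 hG] := powR_bounded b (- s) a0.
  exists (G + 1)^-1 => [|u hu]; first by rewrite invr_gt0 ltr_wpDl.
  have u0 : 0 < u by case/andP: hu => /(lt_le_trans a0).
  have := hG u hu; rewrite powRN ger0_norm ?invr_ge0 ?powR_ge0 // => h.
  rewrite -[leRHS]invrK lef_pV2 ?posrE ?invr_gt0 ?powR_gt0 ?ltr_wpDl //.
  by rewrite (le_trans h) // lerDl.
pose a1 := Num.min a' m; pose b1 := Num.max b' F.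
have a10 : 0 < a1 by rewrite lt_min a0'.
have aa1 : a1 <= a' by rewrite ge_min lexx.
have bb1 : b' <= b1 by rewrite le_max lexx.
have ab1 : a1 < b1 by rewrite (le_lt_trans aa1) // (lt_le_trans ab').
have abP1 := between_widen Hdot abP aa1 bb1.
have ct := oppow_calculus t a10 ab1 abP1.
have cst := oppow_calculus (s * t) a0 ab abT.
apply: funext => x; apply/eqP; rewrite -subr_eq0; apply/eqP.
apply: (@vnorm_small _ _ _ (2 * vnorm x)) => [|d d0]; first by rewrite mulr_ge0 ?vnorm_ge0.
have [p hp] := calc_approx ct d0.
have h1 := calc_spec ct (ltW d0) hp x.
have h2 : vnorm (rpoly_op p (oppow T s) x - oppow T (s * t) x) <= d * vnorm x.
  apply: (calculus_dist (calculus_poly Hdot abT p cs) cst (ltW d0)) => u hu.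
  rewrite powRrM hp // /a1 /b1 ge_min le_max hm // orbT /=.
  by rewrite (le_trans (ler_norm _) (hF u hu)) orbT.
rewrite (le_trans (vnorm_dist (rpoly_op p (oppow T s) x) _ _)) // vnorm_distC; lra.
Qed.

(** [p(XY) X = X p(YX)] for polynomials passes to the limit, on an interval
    that contains both spectra. *)
Lemma oppow_swap X Y s x : bounded_operator X -> bounded_operator Y ->
  posdef (X \o Y) -> posdef (Y \o X) ->
  oppow (X \o Y) s (X x) = X (oppow (Y \o X) s x).
Proof.
move=> bX bY /(posdef_between Hdot)[a [b [a0 ab abXY]]].
move=> /(posdef_between Hdot)[a' [b' [a0' ab' abYX]]].
pose a1 := Num.min a a'; pose b1 := Num.max b b'.
have a10 : 0 < a1 by rewrite lt_min a0.
have a1a : a1 <= a by rewrite ge_min lexx.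
have bb1 : b <= b1 by rewrite le_max lexx.
have ab1 : a1 < b1 by rewrite (le_lt_trans a1a) // (lt_le_trans ab).
have c1 := oppow_calculus s a10 ab1 (between_widen Hdot abXY a1a bb1).
have a1a' : a1 <= a' by rewrite ge_min lexx orbT.
have bb1' : b' <= b1 by rewrite le_max lexx orbT.
have c2 := oppow_calculus s a10 ab1 (between_widen Hdot abYX a1a' bb1').
have [c c0 hc] := bop_bound bX; have lX := bop_lin bX.
apply/eqP; rewrite -subr_eq0; apply/eqP.
apply: (@vnorm_small _ _ _ (2 * (c * vnorm x))) => [|d d0].
  by rewrite !mulr_ge0 ?vnorm_ge0 // ltW.
have [p hp] := calc_approx c1 d0.
have h1 := calc_spec c1 (ltW d0) hp (X x); have h2 := calc_spec c2 (ltW d0) hp x.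
rewrite (le_trans (vnorm_dist (rpoly_op p (X \o Y) (X x)) _ _)) // vnorm_distC.
rewrite (_ : d * _ = d * (c * vnorm x) + c * (d * vnorm x)); last by ring.
rewrite lerD ?(le_trans h1) ?ler_wpM2l ?(ltW d0) //.
rewrite /rpoly_op poly_op_swap // -(linB lX) (le_trans (hc _)) //.
by rewrite ler_wpM2l ?(ltW c0).
Qed.

Lemma iter_oppow T n : posdef T -> iter n T = oppow T n%:R.
Proof.
move=> pT; elim: n => [|n ih]; apply: funext => x /=; first by rewrite oppow0.
by rewrite ih -{1}(oppow1 pT) oppowD // nat1r.
Qed.

Lemma oppow_exponent T s : posdef T -> exists2 L, 0 <= L &
  forall u x, `|u - s| <= 1 ->
  vnorm (oppow T u x - oppow T s x) <= L * `|u - s| * vnorm x.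
Proof.
move=> /(posdef_between Hdot)[a [b [a0 ab abT]]].
have [L L0 hL] := powR_exponent b s a0; exists L => // u x us.
apply: (calculus_dist (oppow_calculus u a0 ab abT) (oppow_calculus s a0 ab abT)).
  by rewrite mulr_ge0.
by move=> t ht; exact: hL.
Qed.

End OperatorPowers.

(** * The Loewner-Heinz and Furuta inequalities *)

Section OperatorInequalities.
Variables (R : realType) (H : completeNormedModType R[i]).
Variable dot : {dot H for (@Num.conj R[i])}.
Hypothesis Hdot : hilbert_form dot.
Local Open Scope complex_scope.
Implicit Types (A B C P Q X Y : H -> H) (x y : H) (a b c s t r : R).
Local Notation ip := (rip dot).
Local Notation self_adjoint := (self_adjoint dot).
Local Notation posdef := (posdef dot).

(** The Loewner order, without the symmetry that [op_ge] records. *)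
Definition qle X Y := forall x, ip (X x) x <= ip (Y x) x.

Lemma op_geP X Y : op_ge dot X Y <->
  [/\ self_adjoint X, self_adjoint Y & qle Y X].
Proof.
split=> [[sX sY /op_nonnegP[_ h]]|[sX sY h]]; split=> //.
  by move=> x; have := h x; rewrite /= ipDl ipNl subr_ge0.
apply/op_nonnegP; split=> [|x]; first exact: sa_sub.
by rewrite /= ipDl ipNl subr_ge0.
Qed.

Lemma posdef_sa P : posdef P -> self_adjoint P.
Proof. by case=> /op_nonnegP[]. Qed.

Lemma posdef_lower P : posdef P -> exists2 a, 0 < a & lower_bound dot a P.
Proof. by move=> /(posdef_between Hdot)[a [b [a0 _ [_ aP _]]]]; exists a. Qed.

Lemma posdef_conj C P : posdef C -> posdef P -> posdef (C \o P \o C).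
Proof.
move=> pC pP; have sC := posdef_sa pC; have [/op_nonnegP[sP P0] iP] := pP.
split; last by apply: op_inv_comp pC.2; exact: op_inv_comp pC.2 iP.
apply/op_nonnegP; split=> [|x]; first exact: sa_conj.
by rewrite /= (sa_ip sC).
Qed.

(** If [D = P - Q >= m] with [m < 0] and [E = D - m], then [P^2 >= Q^2] forces
    [<E x, P x> >= - m <P x, x>], and Cauchy-Schwarz for the form of [E] turns
    this into a positive lower bound of [E]: the bound [m] was not optimal. *)
Lemma square_mono P Q : posdef P -> posdef Q ->
  qle (Q \o Q) (P \o P) -> qle Q P.
Proof.
move=> pP pQ QP; have sP := posdef_sa pP; have sQ := posdef_sa pQ.
pose D x := P x - Q x; have sD : self_adjoint D by exact: sa_sub.
have DE x : D x = P x - Q x by []; clearbody D.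
suff D0 : forall x, 0 <= ip (D x) x.
  by move=> x; have := D0 x; rewrite DE ipDl ipNl subr_ge0.
apply: bottom_principle => // m m0 hm.
pose E x := D x - m%:C *: x; have sE : self_adjoint E by exact: sa_shift.
have EE x : E x = D x - m%:C *: x by []; clearbody E.
have E0 x : 0 <= ip (E x) x by rewrite EE ipDl ipNl ipZl subr_ge0.
have [dl dl0 hP] := posdef_lower pP.
have [e e0 he] := sa_upper Hdot sE.
have [k k0 hk] := bop_bound (sa_bop sP).
have K0 : 0 < e * k ^+ 2 by rewrite mulr_gt0 // exprn_gt0.
exists ((m * dl) ^+ 2 / (e * k ^+ 2)) => [|x].
  by rewrite divr_gt0 // exprn_even_gt0 //= mulf_neq0 ?(lt_eqF m0) ?(gt_eqF dl0).
have [->|x0] := eqVneq x 0; first by rewrite (lin0 (sa_lin sD)) !ip0l mulr0.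
have N0 : 0 < ip x x.
  rewrite lt_def ip_ge0 // andbT ipxx // sqrf_eq0.
  by apply: contra_neq x0; exact: vnorm_eq0.
suff : (m * dl) ^+ 2 / (e * k ^+ 2) * ip x x <= ip (E x) x.
  by rewrite EE ipDl ipNl ipZl; lra.
rewrite mulrAC ler_pdivrMr //.
have h1 : - m * dl * ip x x <= ip (E x) (P x).
  have := QP x; rewrite /= (sa_ip sP (P x)) (sa_ip sQ (Q x)).
  have QE : Q x = P x - D x by rewrite DE opprB addrC subrK.
  rewrite QE !(ipDl, ipDr, ipNl, ipNr) (ipC _ (P x) (D x)) => h2.
  have h3 := ip_ge0 Hdot (D x).
  have h4 := hP x; rewrite EE ipDl ipNl ipZl (ipC _ x (P x)).
  have : - m * (dl * ip x x) <= - m * ip (P x) x by rewrite ler_wpM2l // oppr_ge0 ltW.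
  by lra.
have h5 := form_CS x (P x) (sa_lin sE) (sa_ip sE) E0.
have h6 : ip (E (P x)) (P x) <= e * k ^+ 2 * ip x x.
  rewrite (le_trans (ler_norm _)) // (le_trans (he _)) // -mulrA ler_wpM2l ?(ltW e0) //.
  rewrite !ipxx // -exprMn ler_pXn2r ?nnegrE ?mulr_ge0 ?vnorm_ge0 ?(ltW k0) //.
rewrite -(ler_pM2r N0) -[leRHS]mulrA.
have -> : (m * dl) ^+ 2 * ip x x * ip x x = (- m * dl * ip x x) ^+ 2 by ring.
apply: le_trans (ler_wpM2l (E0 x) h6); apply: le_trans h5.
have l0 : 0 <= - m * dl * ip x x by rewrite !mulr_ge0 ?oppr_ge0 ?ip_ge0 // ltW.
by rewrite ler_pXn2r ?nnegrE // (le_trans l0).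
Qed.

Lemma oppow_ip P s x y : posdef P -> ip (oppow P s x) y = ip x (oppow P s y).
Proof. by move=> pP; exact: (sa_ip (oppow_sa Hdot s pP)). Qed.

(** With [u = P^-1 x] and [v = Q^-1 x], Cauchy-Schwarz for the form of [Q] gives
    [<u, x>^2 = <u, Q v>^2 <= <Q u, u> <v, x>], and [<Q u, u> <= <P u, u> = <u, x>]. *)
Lemma inv_anti P Q : posdef P -> posdef Q -> qle Q P ->
  qle (oppow P (- 1)) (oppow Q (- 1)).
Proof.
move=> pP pQ QP x; set u := oppow P (- 1) x; set v := oppow Q (- 1) x.
have Pu : P u = x by rewrite -{1}(oppow1 Hdot pP) /u (oppowKN Hdot).
have Qv : Q v = x by rewrite -{1}(oppow1 Hdot pQ) /v (oppowKN Hdot).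
have sQ := posdef_sa pQ; have [/op_nonnegP[_ Q0] _] := pQ.
have h1 := form_CS v u (sa_lin sQ) (sa_ip sQ) Q0; rewrite Qv in h1.
have h2 := QP u; rewrite Pu in h2; rewrite !(ipC _ x) in h1 h2.
have v0 : 0 <= ip v x by rewrite ipC -{1}Qv Q0.
have [->//|u0] := eqVneq (ip u x) 0.
have up : 0 < ip u x by rewrite lt_def u0 (le_trans (Q0 u)).
by rewrite -(ler_pM2r up) -expr2 (le_trans h1) // ler_wpM2l.
Qed.

Section LoewnerHeinz.
Variables (A B : H -> H) (pA : posdef A) (pB : posdef B) (BA : qle B A).

Let good s := qle (oppow B s) (oppow A s).

(** With [D = B ^ u], [C = A ^ u] and [2u = s + t], the order at [s] and [t]
    gives [D A^-s D <= B^t <= A^t = C A^-s C]; conjugating by [A ^ (-s/2)]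
    turns this into a comparison of squares. *)
Lemma good_midpoint s t : good s -> good t -> good ((s + t) / 2).
Proof.
move=> gs gt; set u := (s + t) / 2.
have pAs := oppow_posdef Hdot (- s / 2) pA.
have invs : qle (oppow A (- s)) (oppow B (- s)).
  have := inv_anti (oppow_posdef Hdot s pA) (oppow_posdef Hdot s pB) gs.
  by rewrite !(oppowM Hdot) // mulrN1.
have := @square_mono (oppow A (- s / 2) \o oppow A u \o oppow A (- s / 2))
                     (oppow A (- s / 2) \o oppow B u \o oppow A (- s / 2)).
move=> /(_ (posdef_conj pAs (oppow_posdef Hdot u pA))
           (posdef_conj pAs (oppow_posdef Hdot u pB))) sq.
have {}sq : qle (oppow A (- s / 2) \o oppow B u \o oppow A (- s / 2))
                (oppow A (- s / 2) \o oppow A u \o oppow A (- s / 2)).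
  have fold W x : self_adjoint W -> let y := oppow A (- s / 2) x in
      ip (oppow A (- s / 2) (W (oppow A (- s / 2) (oppow A (- s / 2) (W y))))) x =
      ip (oppow A (- s) (W y)) (W y).
    by move=> sW /=; rewrite oppow_ip // (oppow_half Hdot) // (sa_ip sW).
  have cancel C y : posdef C -> ip (oppow C (- s) (oppow C u y)) (oppow C u y) = ip (oppow C t y) y.
    move=> pC; rewrite -(oppow_ip u _ y pC).
    rewrite (oppowD Hdot u _ _ pC) (oppowD Hdot _ u _ pC).
    by have -> : u - s + u = t by rewrite /u; field.
  apply: sq => x /=; rewrite (fold _ _ (oppow_sa Hdot u pB)) (fold _ _ (oppow_sa Hdot u pA)).
  by rewrite (le_trans (invs _)) // !cancel.
move=> z; have := sq (oppow A (s / 2) z); rewrite /= !(oppow_ip _ _ (oppow A (s / 2) z)) //.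
by rewrite mulNr !(oppowNK Hdot).
Qed.

Lemma good_dense s d : 0 <= s <= 1 -> 0 < d -> exists2 l, good l & `|l - s| <= d.
Proof.
move=> /andP[s0 s1] d0.
have g0 : good 0 by move=> x; rewrite !(oppow0 Hdot).
have g1 : good 1 by move=> x; rewrite !(oppow1 Hdot).
have bisect n : exists l h, [/\ good l, good h, l <= s, s <= h & h - l = 2^-1 ^+ n].
  elim: n => [|n [l [h [gl gh ls sh hl]]]].
    by exists 0, 1; split; rewrite // subr0.
  have gm := good_midpoint gl gh.
  have [sm|ms] := lerP s ((l + h) / 2).
    by exists l, ((l + h) / 2); split=> //; rewrite exprS -hl; field.
  by exists ((l + h) / 2), h; split=> //; [exact: ltW|rewrite exprS -hl; field].
have [l [h [gl _ ls sh hl]]] := bisect (Num.truncn d^-1).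
exists l => //; rewrite distrC ger0_norm ?subr_ge0 //.
rewrite (le_trans (y := h - l)) ?lerB // hl exprVn.
rewrite -[leRHS]invrK lef_pV2 ?posrE ?invr_gt0 ?exprn_gt0 //.
rewrite ltW // (lt_le_trans (truncnS_gt _)) // -natrX ler_nat.
exact: ltn_expl.
Qed.

(** The Loewner-Heinz inequality: the exponents that preserve [B <= A] form a
    closed set, stable under midpoints, that contains 0 and 1. *)
Lemma loewner_heinz s : 0 <= s <= 1 -> qle (oppow B s) (oppow A s).
Proof.
move=> s01 x.
have [LA LA0 hA] := oppow_exponent Hdot s pA; have [LB LB0 hB] := oppow_exponent Hdot s pB.
apply: (@le_small _ _ _ ((LA + LB) * ip x x)) => [|d d0].
  by rewrite mulr_ge0 ?ip_ge0 ?addr_ge0.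
have d1 : 0 < Num.min 1 d by rewrite lt_min ltr01.
have [l gl] := good_dense s01 d1; rewrite le_min => /andP[l1 ld].
have close (P : H -> H) L : 0 <= L -> vnorm (oppow P l x - oppow P s x) <= L * `|l - s| * vnorm x ->
    `|ip (oppow P l x) x - ip (oppow P s x) x| <= L * d * ip x x.
  move=> L0 h; rewrite -ipNl -ipDl (le_trans (ip_CS Hdot _ _)) // ipxx // expr2 mulrA.
  rewrite ler_wpM2r ?vnorm_ge0 // (le_trans h) // ler_wpM2r ?vnorm_ge0 //.
  by rewrite ler_wpM2l.
have triangle (v w v' w' e f : R) : `|v - w| <= e -> `|v' - w'| <= f -> v' <= v ->
    w' <= w + (e + f) by rewrite !ler_norml => /andP[? ?] /andP[? ?]; lra.
have -> : d * ((LA + LB) * ip x x) = LA * d * ip x x + LB * d * ip x x by ring.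
exact: triangle (close _ _ LA0 (hA l x l1)) (close _ _ LB0 (hB l x l1)) (gl x).
Qed.

Lemma loewner_heinz_neg s : -1 <= s <= 0 -> qle (oppow A s) (oppow B s).
Proof.
move=> s01; have h : qle (oppow B (- s)) (oppow A (- s)).
  by apply: loewner_heinz; lra.
have := inv_anti (oppow_posdef Hdot (- s) pA) (oppow_posdef Hdot (- s) pB) h.
by rewrite !(oppowM Hdot) // mulrN1 opprK.
Qed.

End LoewnerHeinz.

Lemma sandwichE A B r q x :
  sandwich A B r q x = oppow A (r / 2) (oppow B q (oppow A (r / 2) x)).
Proof. by []. Qed.

Lemma sandwich_posdef A B r q : posdef A -> posdef B -> posdef (sandwich A B r q).
Proof. by move=> pA pB; apply: posdef_conj; exact: oppow_posdef. Qed.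

(** With [X = A^(r/2) B^(q/2)] and [Y = B^(q/2) A^(r/2)] the sandwich is [XY], and
    [(XY)^(1 + s) = (XY)^s X Y = X (YX)^s Y]. *)
Lemma sandwich_pow A B r q s x : posdef A -> posdef B ->
  oppow (sandwich A B r q) (1 + s) x =
  oppow A (r / 2) (oppow B (q / 2) (oppow (sandwich B A q r) s
    (oppow B (q / 2) (oppow A (r / 2) x)))).
Proof.
move=> pA pB; have pAB := sandwich_posdef r q pA pB; have pBA := sandwich_posdef q r pB pA.
pose X := oppow A (r / 2) \o oppow B (q / 2).
pose Y := oppow B (q / 2) \o oppow A (r / 2).
have XY : sandwich A B r q = X \o Y.
  by apply: funext => y; rewrite /sandwich /X /Y /= (oppow_half Hdot).
have YX : sandwich B A q r = Y \o X.
  by apply: funext => y; rewrite /sandwich /X /Y /= (oppow_half Hdot).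
rewrite addrC -(oppowD Hdot) // (oppow1 Hdot) //.
rewrite XY in pAB *; rewrite YX in pBA *.
rewrite -[(X \o Y) x]/(X (Y x)) (oppow_swap Hdot) //.
- exact: (bop_comp (oppow_bop Hdot _ pA) (oppow_bop Hdot _ pB)).
- exact: (bop_comp (oppow_bop Hdot _ pB) (oppow_bop Hdot _ pA)).
Qed.

Lemma sandwich_pow_ip A B r q s x : posdef A -> posdef B ->
  ip (oppow (sandwich A B r q) (1 + s) x) x =
  ip (oppow (sandwich B A q r) s (oppow B (q / 2) (oppow A (r / 2) x)))
     (oppow B (q / 2) (oppow A (r / 2) x)).
Proof. by move=> pA pB; rewrite sandwich_pow // (oppow_ip _ _ x pA) (oppow_ip _ _ _ pB). Qed.

Definition furuta_ineq A B r t :=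
  qle (oppow B (1 + t)) (oppow (sandwich B A t r) ((1 + t) / (t + r))).

(** The exponent is [1 + s] with [-1 <= s <= 0]. As [B^t <= A^t], the operator
    [A^(r/2) B^t A^(r/2)] is below [A^(r + t)], and the power [s] reverses this. *)
Lemma furuta_small A B r t : posdef A -> posdef B -> qle B A -> 1 <= r ->
  0 <= t <= 1 -> furuta_ineq A B r t.
Proof.
move=> pA pB BA r1 t01 x; have [t0 t1] := andP t01.
have tr : 0 < t + r by rewrite ltr_wpDl // (lt_le_trans ltr01).
pose s := (1 - r) / (t + r).
have -> : (1 + t) / (t + r) = 1 + s by rewrite /s; field; rewrite gt_eqF.
have s01 : -1 <= s <= 0.
  rewrite /s ler_pdivlMr // ler_pdivrMr // mul0r mulN1r; lra.
have pAB := sandwich_posdef r t pA pB; have pArt := oppow_posdef Hdot (r + t) pA.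
have le1 : qle (sandwich A B r t) (oppow A (r + t)).
  move=> y; rewrite /sandwich /= oppow_ip // (le_trans (loewner_heinz pA pB BA t01 _)) //.
  by rewrite -(oppow_ip _ _ y pA) !(oppowD Hdot) // (_ : r / 2 + t + r / 2 = r + t) //; field.
rewrite sandwich_pow_ip //.
apply: le_trans (loewner_heinz_neg pArt pAB le1 s01 _).
rewrite (oppowM Hdot) // (_ : (r + t) * s = 1 - r); last by rewrite /s; field; rewrite gt_eqF.
rewrite -(oppow_ip _ _ (oppow B (t / 2) x) pA) !(oppowD Hdot) //.
rewrite (_ : r / 2 + (1 - r) + r / 2 = 1); last by field.
rewrite (oppow1 Hdot) //; apply: le_trans (BA _).
rewrite -{2}(oppow1 Hdot pB) -(oppow_ip _ _ x pB) !(oppowD Hdot) //.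
by rewrite (_ : t / 2 + 1 + t / 2 = 1 + t) //; field.
Qed.

(** For [t > 1], put [t' = (t - 1) / 2]. The inequality for [t'] orders a new
    pair, [B^(1+t') <= (B^(t'/2) A^r B^(t'/2))^((1+t')/(t'+r))], and the inequality
    with [t = 1] for that pair is the inequality for [t]. Halving reaches
    [t <= 1]. *)
Lemma furuta A B r t : posdef A -> posdef B -> qle B A -> 1 <= r -> 0 <= t ->
  furuta_ineq A B r t.
Proof.
move=> pA pB BA r1 t0; have : t <= (Num.truncn t).+1%:R by rewrite ltW // truncnS_gt.
move: (Num.truncn t) => n; elim: n t t0 => [|n ih] t t0 tn.
  by apply: furuta_small; rewrite ?t0.
have [t1|t1] := lerP t 1; first by apply: furuta_small; rewrite ?t0.
pose t' := (t - 1) / 2; have t'0 : 0 <= t' by rewrite divr_ge0 ?subr_ge0 // ltW.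
have tE : t = 1 + 2 * t' by rewrite /t'; field.
have t'n : t' <= n.+1%:R by move: tn; rewrite tE -natr1; have := ler0n R n.+1; lra.
have c0 : 0 < 1 + t' by rewrite ltr_pwDl.
have tr : 0 < t' + r by rewrite ltr_wpDl // (lt_le_trans ltr01).
have F := ih _ t'0 t'n; rewrite /furuta_ineq in F.
have pS := sandwich_posdef t' r pB pA.
pose r' := (t' + r) / (1 + t').
have r'1 : 1 <= r' by rewrite /r' ler_pdivlMr // mul1r addrC lerD2l.
pose e' := (1 + t') / (t' + r).
have swE : sandwich (oppow B (1 + t')) (oppow (sandwich B A t' r) e') 1 r' =
    sandwich B A t r.
  apply: funext => y; rewrite sandwichE (oppowM Hdot (1 + t') (1 / 2) pB).
  rewrite (oppowM Hdot e' r' pS) (_ : e' * r' = 1); last first.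
    by rewrite /e' /r'; field; rewrite !gt_eqF.
  rewrite (oppow1 Hdot pS) !sandwichE !(oppowD Hdot _ _ _ pB).
  have -> : (1 + t') * (1 / 2) + t' / 2 = t / 2 by rewrite tE; field.
  by have -> : t' / 2 + (1 + t') * (1 / 2) = t / 2 by rewrite tE; field.
have := furuta_small (t := 1) (oppow_posdef Hdot e' pS) (oppow_posdef Hdot (1 + t') pB) F r'1.
rewrite ler01 lexx => /(_ isT); rewrite /furuta_ineq swE (oppowM Hdot (1 + t') (1 + 1) pB).
have -> : (1 + t') * (1 + 1) = 1 + t by rewrite tE; ring.
have -> // : (1 + 1) / (1 + r') = (1 + t) / (t + r).
by rewrite tE /r'; field; rewrite !gt_eqF //; lra.
Qed.

End OperatorInequalities.

(** * The power inequality and the operator equation *)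

Section OperatorEquation.
Variables (R : realType) (H : completeNormedModType R[i]).
Variable dot : {dot H for (@Num.conj R[i])}.
Hypothesis Hdot : hilbert_form dot.
Variables (A B : H -> H) (r : R).
Hypotheses (pA : posdef dot A) (pB : posdef dot B) (r1 : 1 <= r).
Local Open Scope complex_scope.
Implicit Types (P S W : H -> H) (x y : H).
Local Notation ip := (rip dot).
Local Notation posdef := (posdef dot).
Local Notation qle := (qle dot).

(** Both sides are compared with [A^(r/2) B^(2 p0 + 1) A^(r/2)]. Rewriting the
    powers [1 + s] of the sandwiches as powers [s] of the reversed ones reduces
    this to the Furuta inequality: for [p0] directly, and for [p] after a power
    between [-1] and [0], which reverses it. *)
Lemma sandwich_mono p0 p n : qle B A -> admissible r p0 p n ->
  qle (oppow (sandwich A B r p) n.+1%:R^-1)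
      (oppow (sandwich A B r p0) ((2 * p0 + 1 + r) / (p0 + r))).
Proof.
move=> BA [p00 pp pn] x.
have r0 : 0 < r by exact: lt_le_trans ltr01 r1.
have p0r : 0 < p0 + r by rewrite ltr_wpDl.
have pp0 : 0 < p by exact: le_lt_trans p00 pp.
have pr : 0 < p + r by rewrite addr_gt0.
have n0 : 0 < n.+1%:R :> R by rewrite ltr0n.
have qp : 2 * p0 + 1 <= p.
  suff : 2 * p0 + 1 + r <= p + r by rewrite lerD2r.
  by rewrite pn ler_peMl ?ler1n // !addr_ge0 ?mulr_ge0 // ltW.
set q := 2 * p0 + 1 in pn qp *; set w := oppow A (r / 2) x.
have q1 : 1 <= q by rewrite /q; lra.
have nE : n.+1%:R^-1 = (q + r) / (p + r).
  have qr : 0 < q + r by rewrite addr_gt0 // (lt_le_trans ltr01).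
  move: n0; rewrite pn; move: (n.+1%:R) => k k0.
  by field; rewrite !gt_eqF.
have collect t u : ip (oppow B t (oppow B u w)) (oppow B u w) = ip (oppow B (u + t + u) w) w.
  by rewrite -(oppow_ip Hdot _ _ w pB) !(oppowD Hdot _ _ _ pB).
apply: (@le_trans _ _ (ip (oppow B q w) w)).
  pose s := - (p - q) / (p + r).
  have -> : n.+1%:R^-1 = 1 + s by rewrite nE /s; field; rewrite gt_eqF.
  rewrite (sandwich_pow_ip Hdot r p s x pA pB) -/w.
  have F := furuta Hdot pA pB BA r1 (ltW pp0); rewrite /furuta_ineq in F.
  have pS := sandwich_posdef Hdot p r pB pA.
  pose v := - (p - q) / (1 + p).
  have p1 : 0 < 1 + p by rewrite addr_gt0.
  have v01 : -1 <= v <= 0.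
    by rewrite /v ler_pdivlMr // ler_pdivrMr // mul0r mulN1r; lra.
  have := loewner_heinz_neg Hdot (oppow_posdef Hdot ((1 + p) / (p + r)) pS)
    (oppow_posdef Hdot (1 + p) pB) F v01 (oppow B (p / 2) w).
  rewrite (oppowM Hdot _ _ pS) (oppowM Hdot _ _ pB) collect.
  have -> : (1 + p) / (p + r) * v = s by rewrite /v /s; field; rewrite !gt_eqF.
  by have -> : p / 2 + (1 + p) * v + p / 2 = q by rewrite /v; field; rewrite gt_eqF.
pose s := (1 + p0) / (p0 + r).
have -> : (q + r) / (p0 + r) = 1 + s by rewrite /s /q; field; rewrite gt_eqF.
rewrite (sandwich_pow_ip Hdot r p0 s x pA pB) -/w.
have F := furuta Hdot pA pB BA r1 p00 (oppow B (p0 / 2) w).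
move: F; rewrite collect.
by have -> // : p0 / 2 + (1 + p0) + p0 / 2 = q by rewrite /q; field.
Qed.

Lemma conj_cancel P s (V W : H -> H) : posdef P ->
  oppow P s \o V \o oppow P s = W <-> V = oppow P (- s) \o W \o oppow P (- s).
Proof.
move=> pP; split=> [<-|->]; apply: funext => x /=.
  by rewrite (oppowKN Hdot s _ pP) (oppowNK Hdot s _ pP).
by rewrite (oppowKN Hdot s _ pP) (oppowNK Hdot s _ pP).
Qed.

(** Positive roots are unique because the powers of [W] recover [W]. *)
Lemma root_iff P W n : posdef P -> posdef W ->
  (P = iter n.+1 W <-> oppow P n.+1%:R^-1 = W).
Proof.
move=> pP pW; have n0 : n.+1%:R != 0 :> R by rewrite pnatr_eq0.
split=> [->|<-].
  by rewrite (iter_oppow Hdot n.+1 pW) (oppowM Hdot _ _ pW) mulfV // (oppow1 Hdot pW).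
have pQ := oppow_posdef Hdot n.+1%:R^-1 pP.
by rewrite (iter_oppow Hdot n.+1 pQ) (oppowM Hdot _ _ pP) mulVf // (oppow1 Hdot pP).
Qed.

Lemma contraction_qle S : posdef S -> (opnorm S <= 1 <-> qle S id).
Proof.
move=> pS; have sS := posdef_sa pS; have bS := sa_bop sS.
split=> [S1 x|S1].
  rewrite (le_trans (ler_norm _)) // (le_trans (ip_CS Hdot _ _)) // ipxx // expr2.
  rewrite ler_wpM2r ?vnorm_ge0 // (le_trans (opnorm_bound x bS)) //.
  by rewrite ler_piMl ?vnorm_ge0.
apply: opnorm_le => // x; apply: (sa_norm Hdot) => // y.
by case: pS => /op_nonnegP[_ ->] _; rewrite mul1r; exact: S1.
Qed.

Section Telescoping.
Variables (X Y S : H -> H) (n : nat).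
Hypothesis YY : forall x, Y (Y x) = X x.

Lemma iter_left x : Y (S (iter n (X \o S) (Y x))) = iter n.+1 (Y \o S \o Y) x.
Proof.
rewrite /=; congr (Y (S _)); elim: n => [|k ih] //=.
by rewrite ih -YY.
Qed.

Lemma iter_right x : Y (iter n (S \o X) (S (Y x))) = iter n.+1 (Y \o S \o Y) x.
Proof.
rewrite /=; congr (Y _); elim: n => [|k ih] //=.
by rewrite ih -YY.
Qed.

End Telescoping.

Section Equation.
Variables (p0 p : R) (n : nat).
Hypothesis adm : admissible r p0 p n.
Let e : R := (2 * p0 + 1 + r) / (p0 + r).
Let h : R := (2 * p0 + 1 + r) / (2 * p0 + 2 * r).
Let M := sandwich A B r p0.
Let N := sandwich A B r p.
Let X := oppow M e.
Let Y := oppow M h.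
Let Z := oppow N n.+1%:R^-1.

Let pM : posdef M. Proof. exact: sandwich_posdef. Qed.
Let pN : posdef N. Proof. exact: sandwich_posdef. Qed.
Let pY : posdef Y. Proof. exact: (oppow_posdef Hdot h pM). Qed.
Let pZ : posdef Z. Proof. exact: (oppow_posdef Hdot _ pN). Qed.

Let YY x : Y (Y x) = X x.
Proof.
have [p00 _ _] := adm; have r0 : 0 < r by exact: lt_le_trans ltr01 r1.
rewrite /Y /X (oppowD Hdot h h x pM); congr (oppow M _ x).
by rewrite /h /e; field; rewrite !gt_eqF //; lra.
Qed.

Let cancel_A (V : H -> H) :
  oppow B p = oppow A (- (r / 2)) \o V \o oppow A (- (r / 2)) <-> N = V.
Proof. by split=> [/(conj_cancel (r / 2) _ _ pA)|/(conj_cancel (r / 2) _ _ pA)]. Qed.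

(** Since [Y^2 = X], both products in the equation telescope to
    [(Y S Y)^(n+1)], so the equation says that [Y S Y] is the root of [N]. *)
Lemma equation_root S : equation_contraction dot A B r p0 p n S <->
  [/\ posdef S, opnorm S <= 1 & Y \o S \o Y = Z].
Proof.
have root pS := @root_iff N (Y \o S \o Y) n pN (posdef_conj pY pS).
have El : Y \o S \o iter n (X \o S) \o Y = iter n.+1 (Y \o S \o Y).
  by apply: funext => x; exact: (iter_left S n YY x).
have Er : Y \o iter n (S \o X) \o S \o Y = iter n.+1 (Y \o S \o Y).
  by apply: funext => x; exact: (iter_right S n YY x).
split=> [[pS nS eq1 _]|[pS nS E]]; split=> //.
- by apply/esym/(root pS); rewrite -El; apply/cancel_A; exact: eq1.
- by have := (cancel_A _).2 ((root pS).2 (esym E)); rewrite -El.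
- by have := (cancel_A _).2 ((root pS).2 (esym E)); rewrite -Er.
Qed.

(** The only candidate is [S = Y^-1 Z Y^-1], and it is a contraction exactly
    when [Z = Y S Y <= Y^2 = X]. *)
Lemma ineq_equation : sandwich_ineq dot A B r p0 p n <->
  exists! S, equation_contraction dot A B r p0 p n S.
Proof.
have congr_Y S : posdef S -> Y \o S \o Y = Z -> (qle S id <-> qle Z X).
  move=> pS <-; split=> hS x.
    by rewrite -YY /= !(oppow_ip Hdot _ _ x pM); exact: hS.
  have := hS (oppow M (- h) x); rewrite -YY /= !(oppow_ip Hdot _ _ (oppow M (- h) x) pM).
  by rewrite /Y !(oppowKN Hdot h _ pM).
have -> : sandwich_ineq dot A B r p0 p n <-> qle Z X.
  split=> [/op_geP[]//|ZX]; apply/op_geP; split=> //; exact: oppow_sa.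
split=> [ZX|[S [/equation_root[pS nS E] _]]]; last first.
  by apply/(congr_Y S pS E)/contraction_qle.
pose S := oppow M (- h) \o Z \o oppow M (- h).
have pS : posdef S by exact: posdef_conj (oppow_posdef Hdot (- h) pM) pZ.
have E : Y \o S \o Y = Z by apply/(conj_cancel h _ _ pM).
exists S; split.
  by apply/equation_root; split=> //; apply/contraction_qle => //; apply/(congr_Y S pS E).
by move=> S' /equation_root[_ _ /(conj_cancel h _ _ pM) ->].
Qed.

End Equation.

(** The instance [p0 = 0], [n = 0], [p = 1] reads
    [A^(1 + r) >= A^(r/2) B A^(r/2)]. *)
Lemma ineq_order : sandwich_ineq dot A B r 0 1 0 -> qle B A.
Proof.
have r0 : 0 < r by exact: lt_le_trans ltr01 r1.
move=> /op_geP[_ _ h] z.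
have S0 : sandwich A B r 0 = oppow A r.
  by apply: funext => x; rewrite sandwichE (oppow0 Hdot _ pB) (oppow_half Hdot _ _ pA).
have := h (oppow A (- (r / 2)) z).
rewrite S0 (oppowM Hdot _ _ pA) invr1 (oppow1 Hdot (sandwich_posdef Hdot r 1 pA pB)).
have -> : r * ((2 * 0 + 1 + r) / (0 + r)) = r / 2 + 1 + r / 2.
  by field; rewrite gt_eqF.
rewrite sandwichE (oppow1 Hdot pB) -!(oppowD Hdot _ _ _ pA) (oppow1 Hdot pA).
by rewrite !(oppow_ip Hdot _ _ _ pA) !(oppowKN Hdot (r / 2) _ pA).
Qed.

End OperatorEquation.

Theorem theorem3p2 (R : realType) (H : completeNormedModType R[i])
  (dot : {dot H for (@Num.conj R[i])}) (Hdot : hilbert_form dot)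
  (A B : H -> H) (Apos : posdef dot A) (Bpos : posdef dot B)
  (r : R) (r1 : 1 <= r) :
  [/\ (op_ge dot A B /\ posdef dot B <->
       forall (p0 p : R) (n : nat), admissible r p0 p n ->
         sandwich_ineq dot A B r p0 p n),
      (op_ge dot A B /\ posdef dot B <->
       forall (p0 p : R) (n : nat), admissible r p0 p n ->
         exists! S : H -> H, equation_contraction dot A B r p0 p n S)
    & forall (p0 p : R) (n : nat), admissible r p0 p n ->
        (sandwich_ineq dot A B r p0 p n <->
         exists! S : H -> H, equation_contraction dot A B r p0 p n S)].
Proof.
have equation p0 p n (adm : admissible r p0 p n) :=
  ineq_equation Hdot Apos Bpos r1 adm.
have order_ineq : op_ge dot A B /\ posdef dot B <->
    forall p0 p n, admissible r p0 p n -> sandwich_ineq dot A B r p0 p n.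
  split=> [[/op_geP[_ _ BA] _] p0 p n adm|ineq].
    apply/op_geP; split; last exact: (sandwich_mono Hdot Apos Bpos r1 BA adm).
    - exact: (oppow_sa Hdot _ (sandwich_posdef Hdot r p0 Apos Bpos)).
    - exact: (oppow_sa Hdot _ (sandwich_posdef Hdot r p Apos Bpos)).
  split=> //; apply/op_geP; split; [exact: posdef_sa|exact: posdef_sa|].
  apply: (ineq_order Hdot Apos Bpos r1); apply: ineq.
  by split; rewrite ?ltr01 // mulr0 add0r mul1r.
split=> //.
split=> [/order_ineq ineq p0 p n adm|S_ex].
  by apply/equation => //; exact: ineq.
by apply/order_ineq => p0 p n adm; apply/equation => //; exact: S_ex.
Qed.
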